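(* Let $d\in2\mathbb{N}$, $k\in\mathbb{N}$ with $p:=k-\frac d2\in\mathbb{N}_0$, let $\mu\in\mathbb{N}$, and let $\mathbf{x},\mathbf{x}'\in\mathbb{R}^d$ with $r=\|\mathbf{x}\|>0$, $r'=\|\mathbf{x}'\|>0$, $r\ne r'$. Then $$\begin{aligned} \mathfrak{l}_k^d(\mathbf{x},\mathbf{x}')&=i\,\frac{2^{\mu-\frac12}}{\sqrt\pi}\,p!\,\Gamma(\mu)\,(\zeta^2-1)^{\frac{p+\mu}{2}+\frac14}(2rr')^p\Biggl[\Bigl(\log(rr')+\log(\zeta+\sqrt{\zeta^2-1})+2H_{2p+2\mu}+H_p-H_{p+\mu}-2\beta_{p,d}\Bigr)\\ &\qquad\times(-1)^{p+\mu+1}\sum_{l=0}^p\frac{(-1)^l(l+\mu)C_l^\mu(\cos\gamma)}{(p-l)!(l+p+2\mu)!}Q_{l+\mu-\frac12}^{p+\mu+\frac12}(\zeta)\\ &+(-1)^{p+\mu}\sum_{l=0}^p\frac{(-1)^l(l+\mu)C_l^\mu(\cos\gamma)}{(p-l)!(p+l+2\mu)!}(H_{p+l+2\mu}+H_{p-l})Q_{l+\mu-\frac12}^{p+\mu+\frac12}(\zeta)\\ &+(-1)^{p+\mu+1}\sum_{l=0}^{p-1}\frac{(-1)^l(l+\mu)C_l^\mu(\cos\gamma)}{(p+l+2\mu)!}\sum_{s=0}^{p-l-1}\frac{2l+2s+2\mu+1}{s!(p-l-s)(p+l+s+2\mu+1)}\left[1+\frac{s!(p+l+2\mu)!}{(s+2l+2\mu)!(p-l)!}\right]Q_{l+\mu-\frac12}^{s+l+\mu+\frac12}(\zeta)\\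 &+(-1)^{p+\mu+1}\sum_{l=0}^{p}\frac{(-1)^l(l+\mu)C_l^\mu(\cos\gamma)}{(p-l)!}\sum_{s=0}^{l+\mu-1}\frac{2s+1}{(l+s+\mu)!(p+\mu-s)(p+s+\mu+1)}Q_{l+\mu-\frac12}^{s+\frac12}(\zeta)\\ &+(-1)^\mu\sum_{l=p+1}^\infty\frac{(l+\mu)(l-p-1)!\,C_l^\mu(\cos\gamma)}{(p+l+2\mu)!}Q_{l+\mu-\frac12}^{p+\mu+\frac12}(\zeta)\Biggr]. \end{aligned}$$
   Context: $\mathbb{N}=\{1,2,\ldots\}$, $\mathbb{N}_0=\{0\}\cup\mathbb{N}$; $H_n=\sum_{j=1}^n\frac1j$ ($n\ge1$), $H_0=0$; empty sums are $0$. $C_l^\mu$ is the Gegenbauer polynomial. $\mathfrak{l}_k^d(\mathbf{x},\mathbf{x}'):=\|\mathbf{x}-\mathbf{x}'\|^{2k-d}\left(\log\|\mathbf{x}-\mathbf{x}'\|-\beta_{k-\frac d2,d}\right)$, with $\beta_{p,d}:=\frac12\left(H_p+H_{\frac d2+p-1}-H_{\frac d2-1}\right)$ and $\|\cdot\|$ the Euclidean norm. $\zeta=\frac{r^2+r'^2}{2rr'}$, and $\gamma\in[0,\pi]$ is the separation angle: $\cos\gamma=\frac{(\mathbf{x},\mathbf{x}')}{rr'}$ with $(\cdot,\cdot)$ the Euclidean inner product. For $z>1$ the associated Legendre function of the second kind is $$Q_\nu^\kappa(z)=\frac{\sqrt{\pi}\,e^{i\pi\kappa}\,\Gamma(\nu+\kappa+1)(z^2-1)^{\kappa/2}}{2^{\nu+1}\Gamma(\nu+\frac32)z^{\nu+\kappa+1}}\,{}_2F_1\!\left(\tfrac{\nu+\kappa+1}{2},\tfrac{\nu+\kappa+2}{2};\nu+\tfrac32;\tfrac1{z^2}\right).$$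 *)

(* Defs.v *)
From mathcomp Require Import all_boot all_order all_algebra.
From mathcomp Require Import all_classical all_reals all_analysis.
From mathcomp Require Import complex.

Set Implicit Arguments.
Unset Strict Implicit.
Unset Printing Implicit Defensive.

Import Order.TTheory GRing.Theory Num.Theory.
Import numFieldNormedType.Exports.
Local Open Scope ring_scope.
Local Open Scope complex_scope.

(* The norm that MathComp-Analysis puts on 'rV[R]_d is the sup norm, hence the
   explicit Euclidean structure. *)
Definition dotp (R : realType) (d : nat) (x y : 'rV[R]_d) : R :=
  \sum_(i < d) x 0 i * y 0 i.

Definition enorm (R : realType) (d : nat) (x : 'rV[R]_d) : R :=
  Num.sqrt (dotp x x).

(* [harmonic] is the sequence 1 / n.+1, so this is H_n, with H_0 = 0. *)
Definition harm (R : realType) (n : nat) : R := series harmonic n.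

Definition pochhammer (R : realType) (a : R) (n : nat) : R :=
  \prod_(i < n) (a + i%:R).

(* Euler's limit formula; it gives the Gamma function at every real x that is
   not a nonpositive integer. *)
Definition Gamma (R : realType) (x : R) : R :=
  limn (fun n : nat => n`!%:R * n%:R `^ x / pochhammer x n.+1).

(* Sum of the Gauss series, for |z| < 1 and c not a nonpositive integer. *)
Definition hyp2F1 (R : realType) (a b c z : R) : R :=
  limn (series (fun n : nat =>
    pochhammer a n * pochhammer b n / (pochhammer c n * n`!%:R) * z ^+ n)).

(* C_n^lambda(x) = sum_j (-1)^j (lambda)_{n-j} / (j! (n-2j)!) (2x)^(n-2j) *)
Definition gegenbauer (R : realType) (n : nat) (lambda : R) : {poly R} :=
  \sum_(0 <= j < n./2.+1)
    ((-1) ^+ j * pochhammer lambda (n - j) / (j`! * (n - j.*2)`!)%:R)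
      *: (2 *: 'X) ^+ (n - j.*2).

Definition expi (R : realType) (t : R) : R[i] := cos t +i* sin t.

(* Q_nu^kappa(z), for real degree nu, real order kappa and z > 1 *)
Definition legendreQ (R : realType) (nu kappa z : R) : R[i] :=
  (Num.sqrt pi)%:C * expi (pi * kappa) *
  (Gamma (nu + kappa + 1) * (z ^+ 2 - 1) `^ (kappa / 2)
   / (2 `^ (nu + 1) * Gamma (nu + 3 / 2) * z `^ (nu + kappa + 1))
   * hyp2F1 ((nu + kappa + 1) / 2) ((nu + kappa + 2) / 2) (nu + 3 / 2)
            (1 / z ^+ 2))%:C.

(* beta_{p,d}, for d even and positive, so that all indices are naturals *)
Definition beta_pd (R : realType) (p d : nat) : R :=
  1 / 2 * (harm R p + harm R (d./2 + p - 1) - harm R (d./2 - 1)).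

(* l_k^d(x, x'), for d even, positive and at most 2k *)
Definition frakl (R : realType) (k d : nat) (x x' : 'rV[R]_d) : R :=
  enorm (x - x') ^ ((2 * k)%:Z - d%:Z)
  * (ln (enorm (x - x')) - beta_pd R (k - d./2) d).

(* Main.v *)
(* With t = min(r, r') / max(r, r') one has zeta = (1 + t^2) / (2 t),
   zeta + sqrt(zeta^2 - 1) = 1 / t and |x - x'|^2 = r r' h / t, where
   h = 1 - 2 t cos(gamma) + t^2; hence the left-hand side is, up to a factor,
   h^p (ln h + const), and it is enough to expand h^p ln h in Gegenbauer polynomials.

   The Fourier expansion of ln h follows from the mean value theorem. Multiplication by h
   raises p, and the connection formula (l + mu) C_l^mu = mu (C_l^(mu+1) - C_(l-2)^(mu+1))
   raises mu by an Abel summation. The coefficients stay derivatives in N of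
   sum_j C(N, l + mu + j) C(N, j) t^(2 j) at N = p + mu.

   The functions Q have half-integer order and degree, so they are elementary: their Gauss
   series is a generating function of trinomial coefficients, whose closed form is
   determined by a three-term recursion and a growth bound. In the variable
   v = t^2 / (1 - t^2) the coefficients of both sides are compared by Pfaff's
   transformation, differentiated in a parameter, and the sums with denominators
   (n - a)(n + a + 1) telescope. *)
Require Import Defs.
From mathcomp Require Import all_boot all_order all_algebra.
From mathcomp Require Import all_classical all_reals all_analysis.
From mathcomp Require Import complex ring lra zify.

Set Implicit Arguments.
Unset Strict Implicit.
Unset Printing Implicit Defensive.

Import Order.TTheory GRing.Theory Num.Theory.
Import numFieldNormedType.Exports.
Local Open Scope ring_scope.
Local Open Scope complex_scope.

(** Formally [h ^ p * ln h] is the derivative of [h ^ N] at [N = p], but nothing is differentiated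
    in [N]: [dbin] carries the derivative of the binomial coefficient from [N = 0] upwards by
    Pascal's rule, so that identities resting on Pascal's rule alone pass to the logarithm
    unchanged. In [ecoef], the factor [p! / (p + mu)!] and the shift [H_p - H_(p + mu)] are the
    value and the logarithmic derivative of [Gamma(N + 1) / Gamma(N + mu + 1)] at [N = p]. The break
    at [l = p] comes from the binomials. For [m > n] every [C(n, m + j)] vanishes and its derivative
    is a bare quotient of factorials, so a single function Q survives. For [m <= n] the derivatives
    bring harmonic numbers that depend on the summation index [j]; [alt_sum_kappa] converts these
    into sums over Q of lower order. The two summands of the bracket in the theorem belong to the
    two binomials that can be differentiated. Convergence in [l] needs only crude bounds: the
    coefficients are [O(t ^ l)], and Gegenbauer values grow more slowly than [rho ^ l] for every
    [rho > 1]. *)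

(** * Binomial coefficients, their derivatives in the upper index, and Pfaff's transformation *)

(* The derivative of the binomial coefficient [C(N, i)] in the real variable [N], at [N = n]. *)
Fixpoint dbin (R : realType) (n i : nat) : R :=
  if i isn't i'.+1 then 0 else
  if n is n'.+1 then dbin R n' i + dbin R n' i'
  else (-1) ^+ i' / i%:R.

Lemma dbin0r (R : realType) n : dbin R n 0 = 0.
Proof. by case: n. Qed.

Lemma dbinS (R : realType) n i :
  dbin R n.+1 i.+1 = dbin R n i.+1 + dbin R n i.
Proof. by []. Qed.

Lemma harmS (R : realType) n : harm R n.+1 = harm R n + n.+1%:R^-1.
Proof. by rewrite /harm seriesEnat /= big_nat_recr. Qed.

(** Derivative in [N] of [(i + 1) C(N + 1, i + 1) = (N + 1) C(N, i)]; the undifferentiated binomial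
    comes from the factor [N + 1]. *)
Lemma mul_dbin_diag (R : realType) n i :
  i.+1%:R * dbin R n.+1 i.+1 = 'C(n, i)%:R + n.+1%:R * dbin R n i.
Proof.
elim: n i => [|n IH] i.
  rewrite dbinS; case: i => [|i] /=; first by rewrite bin0 expr0; field.
  rewrite bin0n /= exprS.
  have h1 : i%:R + 1 != 0 :> R by rewrite natr1 pnatr_eq0.
  have h2 : i%:R + 2 != 0 :> R by rewrite -natrD addn2 pnatr_eq0.
  rewrite -[i.+2%:R]natr1 -[i.+1%:R]natr1. field.
  by rewrite h1 /=; move: h2; congr (_ != 0); ring.
case: i => [|i].
  by move: (IH 0%N); rewrite !dbinS !bin0 !dbin0r !mulr0; lra.
have h1 := IH i.+1; have h2 := IH i.
rewrite dbinS mulrDr h1 -[i.+2%:R]natr1 mulrDl h2 mul1r binS natrD dbinS -[n.+2%:R]natr1.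
ring.
Qed.

(** Logarithmic derivative of [Gamma(N + 1) / (i! Gamma(N - i + 1))] at [N = n]. *)
Lemma dbin_small (R : realType) n i : (i <= n)%N ->
  dbin R n i = 'C(n, i)%:R * (harm R n - harm R (n - i)).
Proof.
elim: n i => [|n IH] [|i] // lin; rewrite ?dbin0r ?subn0 ?subrr ?mulr0 //.
have ine : i.+1%:R != 0 :> R by rewrite pnatr_eq0.
apply: (mulfI ine); rewrite mul_dbin_diag IH // harmS subSS [RHS]mulrA.
have -> : i.+1%:R * 'C(n.+1, i.+1)%:R = n.+1%:R * 'C(n, i)%:R :> R.
  by rewrite -!natrM -mul_bin_diag.
have nne : n.+1%:R != 0 :> R by rewrite pnatr_eq0.
by field.
Qed.

(** For an index [i > n] the polynomial [C(N, i)] has a simple zero at [N = n]; its derivative there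
    is the product of the other factors, [n! (-1)^k k!], over [i!]. *)
Lemma dbin_large (R : realType) n k :
  dbin R n (n + k).+1 = (-1) ^+ k * n`!%:R * k`!%:R / (n + k).+1`!%:R.
Proof.
elim: n => [|n IH].
  rewrite add0n /= factS fact0 natrM mulr1.
  have h1 : k.+1%:R != 0 :> R by rewrite pnatr_eq0.
  have h2 : k`!%:R != 0 :> R by rewrite pnatr_eq0 -lt0n fact_gt0.
  by field; rewrite nat1r h2 h1.
have ine : (n + k).+2%:R != 0 :> R by rewrite pnatr_eq0.
rewrite addSn; apply: (mulfI ine); rewrite mul_dbin_diag IH bin_small; last by lia.
rewrite [(n + k).+2`!]factS [n.+1`!]factS (natrM _ (n + k).+2) (natrM _ n.+1).
have h2 : (n + k).+1`!%:R != 0 :> R by rewrite pnatr_eq0 -lt0n fact_gt0.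
move: h2 ine; move: ((n + k).+1`!%:R) ((n + k).+2%:R) => X Y hX hY.
by field; rewrite hX hY.
Qed.

Lemma dbin_bound (R : realType) n i : `|dbin R n i| <= 2 ^+ n.
Proof.
elim: n i => [|n IH] [|i]; rewrite ?dbin0r ?normr0 ?exprn_ge0 //.
  rewrite /= normrM normrX normrN1 !expr1n mul1r ger0_norm ?invr_ge0 //.
  by rewrite invf_le1 ?ltr0n // ler1n.
rewrite dbinS exprS (le_trans (ler_normD _ _)) //.
have -> : 2 * 2 ^+ n = 2 ^+ n + 2 ^+ n :> R by ring.
exact: lerD.
Qed.

Lemma binomial_bound (R : realType) n i : `|'C(n, i)%:R : R| <= 2 ^+ n.
Proof.
rewrite normr_nat -natrX ler_nat.
elim: n i => [|n IH] [|i]; rewrite ?bin0 ?expn_gt0 // binS expnS mul2n -addnn.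
exact: leq_add.
Qed.

(* Pfaff's transformation of a terminating series. Only Pascal's rule is used, so that it
   holds for the binomial coefficients and for their derivatives [dbin] alike. *)
Lemma pfaff_pascal (R : comNzRingType) (q : nat -> nat -> R) (N A m J : nat) (v : R) :
  (forall A i, q A.+1 i.+1 = q A i.+1 + q A i) -> (N < J)%N ->
  \sum_(j < J) 'C(N, j)%:R * q (A + j)%N (m + j)%N * v ^+ j =
  \sum_(j < J) 'C(N, j)%:R * q A (m + j)%N * v ^+ j * (1 + v) ^+ (N - j).
Proof.
move=> qS; elim: N A m J => [|N IH] A m [//|J] ltNJ.
  rewrite !big_ord_recl !big1 /=; last 2 first.
  - by move=> i _; rewrite bin0n !mul0r.
  - by move=> i _; rewrite bin0n !mul0r.
  by rewrite !addn0 subn0 !mulr1.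
(* Pascal's rule in [C(N.+1, j)]. On the left the shifted half is [v] times the same sum at [A.+1]
   and [m.+1], which is why the induction generalises over [A] and [m]. *)
have splitL (F : nat -> R) : \sum_(j < J.+1) 'C(N.+1, j)%:R * F j =
    \sum_(j < J) 'C(N, j)%:R * F j + \sum_(j < J) 'C(N, j)%:R * F j.+1.
  rewrite big_ord_recl !bin0 mul1r.
  under eq_bigr => i _ do rewrite /= binS natrD mulrDl.
  rewrite big_split /= addrA; congr (_ + _).
  have -> : F 0%N + \sum_(i < J) 'C(N, i.+1)%:R * F i.+1 =
     \sum_(i < J.+1) 'C(N, i)%:R * F i.
    by rewrite big_ord_recl bin0 mul1r.
  by rewrite big_ord_recr /= bin_small // mul0r addr0.
under eq_bigr => i _ do rewrite -mulrA.
rewrite (splitL (fun j => q (A + j)%N (m + j)%N * v ^+ j)).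
under [RHS]eq_bigr => i _ do rewrite -!mulrA.
rewrite (splitL (fun j => q A (m + j)%N * (v ^+ j * (1 + v) ^+ (N.+1 - j)))).
under eq_bigr => i _ do rewrite mulrA.
rewrite IH //.
have -> : \sum_(j < J) 'C(N, j)%:R * (q (A + j.+1)%N (m + j.+1)%N * v ^+ j.+1)
  = v * \sum_(j < J) 'C(N, j)%:R * q (A.+1 + j)%N (m.+1 + j)%N * v ^+ j.
  rewrite mulr_sumr; apply: eq_bigr => i _; rewrite !addnS !addSn exprS; ring.
rewrite IH // mulr_sumr -!big_split /=; apply: eq_bigr => j _.
case: (leqP j N) => [le|lt]; last by rewrite bin_small //; ring.
rewrite subSn // subSS addSn addnS qS !exprS; ring.
Qed.

(** * Factorial ratios and telescoping alternating sums *)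

Lemma natf_neq0 (R : realType) n : n`!%:R != 0 :> R.
Proof. by rewrite pnatr_eq0 -lt0n fact_gt0. Qed.

Lemma binomialE (R : realType) n k : (k <= n)%N ->
  'C(n, k)%:R = n`!%:R / (k`!%:R * (n - k)`!%:R) :> R.
Proof.
move=> le_kn; rewrite -(bin_fact le_kn) natrM natrM mulfK //.
Qed.

(* [(a + j)! / (a - j)!], understood as [0] for [j > a] *)
Definition cffact (R : realType) (a j : nat) : R := ((a + j) ^_ j.*2)%:R.

Lemma cffact_small (R : realType) a j : (a < j)%N -> cffact R a j = 0.
Proof. by move=> lt_aj; rewrite /cffact ffact_small //; lia. Qed.

Lemma cffactE (R : realType) a j : (j <= a)%N ->
  cffact R a j = (a + j)`!%:R / (a - j)`!%:R.
Proof.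
move=> le_ja; rewrite -(@ffact_fact (a + j) j.*2); last by lia.
have -> : (a + j - j.*2 = a - j)%N by lia.
by rewrite natrM mulfK // natf_neq0.
Qed.

Lemma cffactSr (R : realType) a j :
  cffact R a j.+1 = (a%:R + j%:R + 1) * (a%:R - j%:R) * cffact R a j.
Proof.
case: (leqP j a) => [le|lt]; last by rewrite !cffact_small ?mulr0 //; lia.
rewrite /cffact doubleS addnS ffactSS ffactnSr.
have -> : (a + j - j.*2 = a - j)%N by lia.
rewrite (natrM _ (a + j).+1) natrM natrB // -natr1 natrD; ring.
Qed.

Lemma cffactSl (R : realType) a j :
  (a%:R + 1 - j%:R) * cffact R a.+1 j = (a%:R + j%:R + 1) * cffact R a j.
Proof.
case: j => [|j]; first by rewrite /cffact !ffactn0; ring.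
case: (leqP j a) => [le|lt]; last by rewrite !cffact_small ?mulr0 //; lia.
rewrite /cffact doubleS addSn ffactSS addnS !ffactnSr.
have -> : ((a + j).+1 - j.*2 = a.+1 - j)%N by lia.
have -> : ((a + j).+1 - j.*2.+1 = a - j)%N by lia.
rewrite !(natrM _ (a + j).+2) !natrM !natrB //; last by lia.
rewrite -[(a + j).+2%:R]natr1 -[(a + j).+1%:R]natr1 -[j.+1%:R]natr1 -[a.+1%:R]natr1 natrD.
ring.
Qed.

(** Telescopes: by [cffactSl] the right-hand side grows by exactly the new term, since
    [(n + j + 1) + (n - j) = 2 n + 1]. *)
Lemma alt_sum_cffact (R : realType) n j :
  \sum_(a < n) (-1) ^+ a * (2 * a + 1)%:R * cffact R a j
    = (-1) ^+ n.+1 * (n%:R - j%:R) * cffact R n j.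
Proof.
elim: n => [|n IH].
  rewrite big_ord0; case: j => [|j]; first by rewrite subrr mulr0 mul0r.
  by rewrite cffact_small // mulr0.
rewrite big_ord_recr /= IH -[n.+1%:R]natr1 -[in RHS]mulrA cffactSl natrD natrM !exprS.
ring.
Qed.

(** For [a < n] this is [1 / (n - a) - 1 / (n + a + 1)]. The denominator equals
    [n (n + 1) - a (a + 1)], a difference of Legendre eigenvalues. *)
Definition kappa (R : realType) (n a : nat) : R :=
  (2 * a + 1)%:R / ((n - a) * (n + a + 1))%:R.

Lemma kappaE (R : realType) n a : (a < n)%N ->
  kappa R n a * ((n%:R - a%:R) * (n%:R + a%:R + 1)) = (2 * a + 1)%:R.
Proof.
move=> lt; rewrite /kappa natrM natrB 1?ltnW // !natrD divfK //.
by rewrite mulf_neq0 // -?natrB -?natrD ?pnatr_eq0 1?ltnW //; lia.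
Qed.

(** Turns the harmonic numbers left by differentiation into the weighted sums of the theorem. The
    induction runs downwards in [j] from [j = n], where both sides vanish. *)
Lemma alt_sum_kappa (R : realType) n j :
  \sum_(a < n) (-1) ^+ (n + a) * kappa R n a * cffact R a j
    = (harm R (n + j) - harm R (2 * n)) * cffact R n j.
Proof.
case: (leqP j n) => [|lt]; last first.
  rewrite cffact_small // mulr0 big1 // => i _.
  by rewrite cffact_small ?mulr0 //; apply: ltn_trans lt.
move=> le; have [k] : exists k, n = (j + k)%N by exists (n - j)%N; lia.
elim: k j le => [|k IH] j le E.
  have -> : (n + j = 2 * n)%N by lia.
  rewrite subrr mul0r big1 // => i _.
  by rewrite cffact_small ?mulr0 //; have := ltn_ord i; lia.
have lt : (j < n)%N by lia.
have := IH j.+1 lt ltac:(lia).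
under eq_bigr => i _.
  rewrite cffactSr.
  (* The factor from [cffactSr] is [(n + j + 1)(n - j) - (n - i)(n + i + 1)]: the first part
     reproduces the sum at [j], the second cancels the denominator of [kappa]. *)
  have -> : (-1) ^+ (n + i) * kappa R n i *
       ((i%:R + j%:R + 1) * (i%:R - j%:R) * cffact R i j) =
     ((n%:R + j%:R + 1) * (n%:R - j%:R)) * ((-1) ^+ (n + i) * kappa R n i * cffact R i j)
     - (-1) ^+ n * ((-1) ^+ i * (kappa R n i * ((n%:R - i%:R) * (n%:R + i%:R + 1))) * cffact R i j).
    by rewrite exprD; ring.
  rewrite kappaE //.
  over.
rewrite sumrB -!mulr_sumr alt_sum_cffact cffactSr.
rewrite addnS harmS => h.
have n0 : (n%:R + j%:R + 1) * (n%:R - j%:R) != 0 :> R.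
  by rewrite mulf_neq0 // -?natrB -?natrD ?pnatr_eq0 1?ltnW //; lia.
have s1 : (-1) ^+ n * (-1) ^+ n = 1 :> R by rewrite -expr2 sqrr_sign.
apply: (mulfI n0); move: h; rewrite exprS -[(n + j).+1%:R]natr1 natrD.
set X := \sum_(a < n) _; set F := cffact R n j => h.
have n1 : n%:R + j%:R + 1 != 0 :> R by rewrite -natrD natr1 pnatr_eq0.
have -> : (n%:R + j%:R + 1) * (n%:R - j%:R) * X =
 (harm R (n + j) + (n%:R + j%:R + 1)^-1 - harm R (2 * n)) *
     ((n%:R + j%:R + 1) * (n%:R - j%:R) * F) - (-1) ^+ n * (-1) ^+ n * (n%:R - j%:R) * F.
  by rewrite -h; ring.
by rewrite s1; field.
Qed.

(** * The polynomial kernel of the Legendre functions *)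

(* Up to a factor this is [2F1(- a, a + 1; m + 1; - v)], the polynomial part of
   [Q_(m - 1/2)^(a + 1/2)]. *)
Definition kerK (R : realType) (m a : nat) (v : R) : R :=
  \sum_(j < a.+1) 'C(a, j)%:R * (a + j)`!%:R / (m + j)`!%:R * v ^+ j.

Lemma kerK_widen (R : realType) m a N (v : R) : (a < N)%N ->
  kerK m a v = \sum_(j < N) 'C(a, j)%:R * (a + j)`!%:R / (m + j)`!%:R * v ^+ j.
Proof.
move=> lt; rewrite /kerK (big_ord_widen N (fun j =>
  'C(a, j)%:R * (a + j)`!%:R / (m + j)`!%:R * v ^+ j)) //= big_mkcond /=; apply: eq_bigr => i _; case: ltnP => // le.
by rewrite bin_small // !mul0r.
Qed.

Lemma kerK_cffact (R : realType) m a N (v : R) : (a < N)%N ->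
  kerK m a v = a`!%:R *
    \sum_(j < N) cffact R a j / (j`!%:R * (m + j)`!%:R) * v ^+ j.
Proof.
move=> lt; rewrite (kerK_widen _ _ lt) mulr_sumr; apply: eq_bigr => i _.
case: (leqP i a) => [le|lt']; last first.
  by rewrite bin_small // cffact_small // !mul0r mulr0.
rewrite cffactE // binomialE //.
move: (natf_neq0 R i) (natf_neq0 R (m + i)) (natf_neq0 R (a - i)).
move: (i`!%:R) ((m + i)`!%:R) ((a - i)`!%:R) => x y z hx hy hz.
by field; rewrite hx hy hz.
Qed.

Lemma binomial_pascal (R : realType) A i : 'C(A.+1, i.+1)%:R = 'C(A, i.+1)%:R + 'C(A, i)%:R :> R.
Proof. by rewrite binS natrD. Qed.

Lemma kerK_binomial (R : realType) m a N (v : R) : (m <= a)%N -> (a < N)%N ->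
  kerK m a v / (a - m)`!%:R = \sum_(j < N) 'C(a, j)%:R * 'C(a + j, m + j)%:R * v ^+ j.
Proof.
move=> le lt; rewrite (kerK_widen _ _ lt) mulr_suml; apply: eq_bigr => i _.
rewrite [X in _ = _ * X * _]binomialE; last by lia.
have -> : (a + i - (m + i) = a - m)%N by lia.
move: (natf_neq0 R (m + i)) (natf_neq0 R (a - m)).
move: ((m + i)`!%:R) ((a - m)`!%:R) => y z hy hz.
by field; rewrite hy hz.
Qed.

Lemma binomial_cffact (R : realType) a m j : (m <= a)%N ->
  'C(a - m, j)%:R * 'C(a + m + j, m + j)%:R
   = (a - m)`!%:R / a`!%:R * (cffact R a (m + j) / (j`!%:R * (m + j)`!%:R)).
Proof.
move=> le; case: (leqP (m + j) a) => le2; last first.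
  by rewrite bin_small ?cffact_small //; [rewrite !mul0r mulr0|lia].
rewrite !binomialE; [|lia|lia].
rewrite cffactE // addnA.
have -> : (a + m + j - (m + j) = a)%N by lia.
have -> : (a - m - j = a - (m + j))%N by lia.
move: (natf_neq0 R (m + j)) (natf_neq0 R a) (natf_neq0 R j) (natf_neq0 R (a - (m + j))).
move: ((m + j)`!%:R) (a`!%:R) (j`!%:R) ((a - (m + j))`!%:R) => x y z t hx hy hz ht.
by field; rewrite hx hy hz ht.
Qed.

(** Rewrites the output of Pfaff's transformation with [N = A = a] as the output of the one with
    [N = a - m] and [A = a + m], so that the latter can be undone. *)
Lemma binomial2_exchange (R : realType) a m j : (m <= a)%N ->
  'C(a, j)%:R * 'C(a, m + j)%:R =
  a`!%:R * a`!%:R / ((a - m)`!%:R * (a + m)`!%:R)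
     * ('C(a - m, j)%:R * 'C(a + m, m + j)%:R) :> R.
Proof.
move=> le; case: (leqP (m + j) a) => le2; last first.
  have lt : (a - m < j)%N by lia.
  by rewrite (bin_small le2) (bin_small lt) !(mul0r, mulr0).
rewrite !binomialE; try lia.
have -> : (a + m - (m + j) = a - j)%N by lia.
have -> : (a - m - j = a - (m + j))%N by lia.
move: (natf_neq0 R (m + j)) (natf_neq0 R (a + m)) (natf_neq0 R j) (natf_neq0 R (a - (m + j)))
  (natf_neq0 R (a - m)) (natf_neq0 R (a - j)).
move: ((m + j)`!%:R) ((a + m)`!%:R) (j`!%:R) ((a - (m + j))`!%:R) ((a - m)`!%:R) ((a - j)`!%:R).
move=> x y z t r s hx hy hz ht hr hs.
by field; rewrite hx hy hz ht hr hs.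
Qed.

(* Euler's transformation of the terminating series [kerK], obtained by applying
   Pfaff's transformation twice. *)
Lemma kerK_euler (R : realType) m a N (v : R) : (m <= a)%N -> (a < N)%N ->
  kerK m a v / (a - m)`!%:R = a`!%:R / (a + m)`!%:R * (1 + v) ^+ m *
    \sum_(j < N) cffact R a (m + j) / (j`!%:R * (m + j)`!%:R) * v ^+ j.
Proof.
move=> le lt; rewrite (kerK_binomial _ le lt).
rewrite (pfaff_pascal a m v (@binomial_pascal R) lt).
under eq_bigr => i _.
  rewrite binomial2_exchange //.
  over.
have -> : \sum_(j < N) cffact R a (m + j) / (j`!%:R * (m + j)`!%:R) * v ^+ j =
  a`!%:R / (a - m)`!%:R * \sum_(j < N) 'C(a - m, j)%:R * 'C(a + m + j, m + j)%:R * v ^+ j.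
  rewrite mulr_sumr; apply: eq_bigr => i _; rewrite binomial_cffact //.
  move: (natf_neq0 R a) (natf_neq0 R (a - m)) (_ / (_ * _)) => hx hy z.
  by field; rewrite hx hy.
have lt' : (a - m < N)%N by lia.
rewrite (pfaff_pascal (a + m) m v (@binomial_pascal R) lt') !mulr_sumr.
apply: eq_bigr => i _.
case: (leqP i (a - m)) => le2; last by rewrite (bin_small le2) !(mul0r, mulr0).
have -> : (a - i = m + (a - m - i))%N by lia.
rewrite exprD.
move: (natf_neq0 R (a - m)) (natf_neq0 R (a + m)).
move: ((a - m)`!%:R) ((a + m)`!%:R) => x y hx hy.
by field; rewrite hx hy.
Qed.

(** * Fourier coefficients expressed through the kernel *)

(* Up to sign and powers of [t], with [u = t ^+ 2], these are the Fourier coefficients of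
   [h ^ n] and [h ^ n * ln h], where [h = 1 - 2 t cos g + t ^ 2 = (1 - t e^(i g)) (1 - t e^(- i g))]. *)
Definition coefA (R : realType) (n m : nat) (u : R) : R :=
  \sum_(j < n.+1) 'C(n, m + j)%:R * 'C(n, j)%:R * u ^+ j.

Definition coefD (R : realType) (n m : nat) (u : R) : R :=
  \sum_(j < n.+1)
    (dbin R n (m + j) * 'C(n, j)%:R + 'C(n, m + j)%:R * dbin R n j) * u ^+ j.

(** With [v = u / (1 - u)] one has [1 + v = 1 / (1 - u)]; this form matches the right-hand side of
    [pfaff_pascal]. *)
Lemma homogenize (R : realType) (n j : nat) (u : R) : u != 1 -> (j <= n)%N ->
  u ^+ j = (1 - u) ^+ n * ((u / (1 - u)) ^+ j * (1 + u / (1 - u)) ^+ (n - j)).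
Proof.
move=> u1 le.
have d : 1 - u != 0 by rewrite subr_eq0 eq_sym.
have -> : 1 + u / (1 - u) = (1 - u)^-1 by field.
rewrite -{1}(subnKC le) exprD expr_div_n exprVn.
have h1 : (1 - u) ^+ j != 0 by rewrite expf_neq0.
have h2 : (1 - u) ^+ (n - j) != 0 by rewrite expf_neq0.
by field; rewrite h1 h2.
Qed.

Lemma coefA_kerK (R : realType) n m (u : R) : u != 1 -> (m <= n)%N ->
  coefA n m u = (1 - u) ^+ n * kerK m n (u / (1 - u)) / (n - m)`!%:R.
Proof.
move=> u1 le; rewrite -mulrA (kerK_binomial _ le (ltnSn n)).
rewrite (pfaff_pascal n m _ (@binomial_pascal R) (ltnSn n)) mulr_sumr.
apply: eq_bigr => j _; rewrite (homogenize u1 (_ : (j <= n)%N)) -1?ltnS //.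
ring.
Qed.

Lemma coefA_eq0 (R : realType) n m (u : R) : (n < m)%N -> coefA n m u = 0.
Proof.
by move=> lt; apply: big1 => j _; rewrite bin_small ?mul0r //; lia.
Qed.

Lemma coefD_left (R : realType) n m (u : R) : u != 1 ->
  \sum_(j < n.+1) dbin R n (m + j) * 'C(n, j)%:R * u ^+ j =
  (1 - u) ^+ n * \sum_(j < n.+1) 'C(n, j)%:R * dbin R (n + j) (m + j) * (u / (1 - u)) ^+ j.
Proof.
move=> u1; rewrite (pfaff_pascal n m _ (@dbinS R) (ltnSn n)) mulr_sumr.
apply: eq_bigr => j _; rewrite (homogenize u1 (_ : (j <= n)%N)) -1?ltnS //.
ring.
Qed.

(** Only the term with [dbin R n (m + j)] survives. After Pfaff's transformation the index exceeds
    the upper argument by [m - n], whatever [j] is, so the factorial and the sign of [dbin_large]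
    leave the sum. *)
Lemma coefD_large (R : realType) n m (u : R) : u != 1 -> (n < m)%N ->
  coefD n m u = (1 - u) ^+ n * (-1) ^+ (m - n - 1) * (m - n - 1)`!%:R
    * kerK m n (u / (1 - u)).
Proof.
move=> u1 lt; rewrite /coefD.
under eq_bigr => j _ do rewrite (@bin_small n (m + j)) ?mul0r ?addr0 1?ltn_addr //.
rewrite coefD_left // -!mulrA; congr (_ * _); rewrite /kerK !mulr_sumr.
apply: eq_bigr => j _.
have -> : dbin R (n + j) (m + j) = dbin R (n + j) (n + j + (m - n - 1)).+1.
  by congr dbin; lia.
rewrite dbin_large.
have -> : (n + j + (m - n - 1)).+1 = (m + j)%N by lia.
ring.
Qed.

Lemma coefD_right (R : realType) n m (u : R) : u != 1 -> (m <= n)%N ->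
  \sum_(j < n.+1) 'C(n, m + j)%:R * dbin R n j * u ^+ j =
  (1 - u) ^+ n * (n`!%:R / (n + m)`!%:R * (1 + u / (1 - u)) ^+ m *
    \sum_(j < n.+1) (harm R (n + m + j) - harm R (n + m)) *
      (cffact R n (m + j) / (j`!%:R * (m + j)`!%:R) * (u / (1 - u)) ^+ j)).
Proof.
move=> u1 le; set v := u / (1 - u).
have nm : (n - m < n.+1)%N by lia.
pose q A i := dbin R A i - (harm R (n + m) - harm R n) * 'C(A, i)%:R.
have qS A i : q A.+1 i.+1 = q A i.+1 + q A i.
  by rewrite /q dbinS binomial_pascal; ring.
have fact_ratio : n`!%:R / (n - m)`!%:R != 0 :> R by rewrite mulf_neq0 ?invr_eq0 ?natf_neq0.
have -> : \sum_(j < n.+1) (harm R (n + m + j) - harm R (n + m)) *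
      (cffact R n (m + j) / (j`!%:R * (m + j)`!%:R) * v ^+ j) =
  n`!%:R / (n - m)`!%:R * \sum_(j < n.+1) 'C(n - m, j)%:R * q (n + m + j)%N (m + j)%N * v ^+ j.
  rewrite mulr_sumr; apply: eq_bigr => j _.
  rewrite /q dbin_small; last by lia.
  have -> : (n + m + j - (m + j) = n)%N by lia.
  have -> : 'C(n - m, j)%:R * ('C(n + m + j, m + j)%:R *
      (harm R (n + m + j) - harm R n) -
       (harm R (n + m) - harm R n) * 'C(n + m + j, m + j)%:R) =
     (harm R (n + m + j) - harm R (n + m)) * ('C(n - m, j)%:R * 'C(n + m + j, m + j)%:R).
    by ring.
  rewrite binomial_cffact //.
  move: (natf_neq0 R n) (natf_neq0 R (n - m)) (cffact _ _ _ / (_ * _)).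
  move: (n`!%:R) ((n - m)`!%:R) => x y hx hy z.
  by field; rewrite hx hy.
rewrite (pfaff_pascal (n + m) m v qS nm) !mulr_sumr.
apply: eq_bigr => j _; rewrite (homogenize u1 (_ : (j <= n)%N)) -1?ltnS // -/v.
case: (leqP (m + j) n) => le2; last first.
  have lt : (n - m < j)%N by lia.
  by rewrite (bin_small le2) (bin_small lt) !(mul0r, mulr0).
have -> : (n - j = m + (n - m - j))%N by lia.
rewrite /q !dbin_small; try lia.
have -> : (n + m - (m + j) = n - j)%N by lia.
rewrite exprD.
have -> : 'C(n, m + j)%:R * ('C(n, j)%:R * (harm R n - harm R (n - j))) =
  ('C(n, j)%:R * 'C(n, m + j)%:R) * (harm R n - harm R (n - j)) by ring.
rewrite binomial2_exchange //.
move: (natf_neq0 R (n - m)) (natf_neq0 R (n + m)).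
move: ((n - m)`!%:R) ((n + m)`!%:R) => x y hx hy.
by field; rewrite hx hy.
Qed.

(** Differentiating either binomial gives a harmonic number running with [j]. Subtracting
    [harm (2 * n)] from it gives what [alt_sum_kappa] expands, at [j] for the first binomial and at
    [m + j] for the second; the constants that remain multiply the kernel of order [n]. *)
Lemma coefD_small (R : realType) n m (u : R) : u != 1 -> (m <= n)%N ->
  coefD n m u = (1 - u) ^+ n *
   ((2 * harm R (2 * n) - harm R (n + m) - harm R (n - m))
        * kerK m n (u / (1 - u)) / (n - m)`!%:R
    + n`!%:R * \sum_(a < n) (-1) ^+ (n + a) * kappa R n a *
        (1 / (n - m)`!%:R + cffact R a m / (n + m)`!%:R)
        * (kerK m a (u / (1 - u)) / a`!%:R)).
Proof.
move=> u1 le; set v := u / (1 - u).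
pose s j := cffact R n j / (j`!%:R * (m + j)`!%:R) * v ^+ j.
pose e j := cffact R n (m + j) / (j`!%:R * (m + j)`!%:R) * v ^+ j.
have KE : kerK m n v / (n - m)`!%:R = n`!%:R / (n - m)`!%:R * \sum_(j < n.+1) s j.
  by rewrite (kerK_cffact _ _ (ltnSn n)); ring.
have KE2 := kerK_euler v le (ltnSn n).
have left_part : \sum_(j < n.+1) dbin R n (m + j) * 'C(n, j)%:R * u ^+ j =
  (1 - u) ^+ n * (n`!%:R / (n - m)`!%:R *
     \sum_(j < n.+1) (harm R (n + j) - harm R (n - m)) * s j).
  rewrite coefD_left //; congr (_ * _); rewrite mulr_sumr; apply: eq_bigr => j _.
  have ltj := ltn_ord j.
  rewrite dbin_small ?leq_add2r // binomialE ?binomialE /s; try lia.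
  rewrite cffactE //.
  have -> : (n + j - (m + j) = n - m)%N by lia.
  move: (natf_neq0 R (m + j)) (natf_neq0 R j) (natf_neq0 R (n - m)) (natf_neq0 R (n - j)).
  move: ((m + j)`!%:R) (j`!%:R) ((n - m)`!%:R) ((n - j)`!%:R) => x y z t hx hy hz ht.
  by rewrite -/v; field; rewrite hx hy hz ht.
have first_sum : \sum_(a < n) (-1) ^+ (n + a) * kappa R n a * (kerK m a v / a`!%:R)
  = \sum_(j < n.+1) (harm R (n + j) - harm R (2 * n)) * s j.
  under eq_bigr => a _.
    rewrite (kerK_cffact _ _ (_ : (a < n.+1)%N)); last by rewrite ltnS ltnW.
    rewrite [a`!%:R * _]mulrC mulfK ?natf_neq0 // mulr_sumr.
    over.
  rewrite exchange_big /=; apply: eq_bigr => j _.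
  rewrite /s mulrA [_ * (_ / _)]mulrA -alt_sum_kappa !mulr_suml; apply: eq_bigr => a _.
  ring.
have second_sum : \sum_(a < n) (-1) ^+ (n + a) * kappa R n a *
     (cffact R a m * (kerK m a v / a`!%:R))
  = (1 + v) ^+ m * \sum_(j < n.+1) (harm R (n + m + j) - harm R (2 * n)) * e j.
  under eq_bigr => a _.
    (* Euler's transformation is applied to every order [a] below [n]; for [a < m] both sides
       vanish. *)
    have -> : cffact R a m * (kerK m a v / a`!%:R) = (1 + v) ^+ m *
      \sum_(j < n.+1) cffact R a (m + j) / (j`!%:R * (m + j)`!%:R) * v ^+ j.
      case: (leqP m a) => lema; last first.
        rewrite cffact_small // mul0r big1 ?mulr0 // => j _.
        by rewrite cffact_small ?mul0r //; lia.
      have lta : (a < n.+1)%N by rewrite ltnS ltnW.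
      have := kerK_euler v lema lta; rewrite cffactE // => h.
      transitivity ((a + m)`!%:R / a`!%:R * (kerK m a v / (a - m)`!%:R)); first by ring.
      rewrite h; move: (natf_neq0 R (a + m)) (natf_neq0 R a).
      move: ((a + m)`!%:R) (a`!%:R) => x y hx hy.
      by field; rewrite hx hy.
    rewrite mulrCA mulr_sumr.
    over.
  rewrite -mulr_sumr exchange_big /=; congr (_ * _); apply: eq_bigr => j _.
  rewrite /e mulrA [_ * (_ / _)]mulrA -addnA -alt_sum_kappa !mulr_suml; apply: eq_bigr => a _.
  ring.
rewrite /coefD.
under eq_bigr => j _ do rewrite mulrDl.
have right_part : \sum_(j < n.+1) 'C(n, m + j)%:R * dbin R n j * u ^+ j =
    (1 - u) ^+ n * (n`!%:R / (n + m)`!%:R * (1 + v) ^+ m *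
      \sum_(j < n.+1) (harm R (n + m + j) - harm R (n + m)) * e j).
  exact: coefD_right.
rewrite big_split /= left_part right_part -mulrDr; congr (_ * _).
have -> : \sum_(a < n) (-1) ^+ (n + a) * kappa R n a *
     (1 / (n - m)`!%:R + cffact R a m / (n + m)`!%:R) * (kerK m a v / a`!%:R) =
   (n - m)`!%:R^-1 * (\sum_(a < n) (-1) ^+ (n + a) * kappa R n a * (kerK m a v / a`!%:R))
   + (n + m)`!%:R^-1 * (\sum_(a < n) (-1) ^+ (n + a) * kappa R n a *
     (cffact R a m * (kerK m a v / a`!%:R))).
  by rewrite !mulr_sumr -big_split; apply: eq_bigr => a _ /=; ring.
rewrite first_sum second_sum.
have sumB c (h : nat -> R) (f : nat -> R) : \sum_(j < n.+1) (h j - c) * f j =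
   \sum_(j < n.+1) h j * f j - c * \sum_(j < n.+1) f j.
  by rewrite mulr_sumr -sumrB; apply: eq_bigr => j _; rewrite mulrBl.
rewrite !(sumB _ (fun j => harm R (n + j))) !(sumB _ (fun j => harm R (n + m + j))).
(* Euler's transformation at order [n] itself identifies the two normalisations, so both constants
   multiply the same kernel. *)
have E : n`!%:R / (n + m)`!%:R * (1 + v) ^+ m * \sum_(j < n.+1) e j = 
  n`!%:R / (n - m)`!%:R * \sum_(j < n.+1) s j by rewrite -KE KE2.
have -> : (2 * harm R (2 * n) - harm R (n + m) - harm R (n - m)) * kerK m n v / (n - m)`!%:R =
  harm R (2 * n) * (n`!%:R / (n - m)`!%:R * \sum_(j < n.+1) s j) +
  (harm R (2 * n) - harm R (n + m)) * (n`!%:R / (n + m)`!%:R * (1 + v) ^+ m * \sum_(j < n.+1) e j)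
   - harm R (n - m) * (n`!%:R / (n - m)`!%:R * \sum_(j < n.+1) s j).
  by rewrite -mulrA KE E; ring.
ring.
Qed.

(** * Recursions of the Fourier coefficients *)

(** Common shape of [coefA] and of the two halves of [coefD]. The length [J] is independent of [n]
    because the recursion shortens some sums by one term. *)
Definition bilin (R : nzRingType) (q1 q2 : nat -> nat -> R) (J n m : nat) (u : R) : R :=
  \sum_(j < J) q1 n (m + j)%N * q2 n j * u ^+ j.

Definition pascal (R : nzRingType) (q : nat -> nat -> R) :=
  forall n, q n.+1 0%N = q n 0%N /\ forall i, q n.+1 i.+1 = q n i.+1 + q n i.

Lemma bilinS (R : comNzRingType) (q1 q2 : nat -> nat -> R) J n m (u : R) :
  pascal q1 -> pascal q2 ->
  bilin q1 q2 J.+1 n.+1 m.+1 u =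
  bilin q1 q2 J.+1 n m.+1 u + bilin q1 q2 J.+1 n m u
   + u * (bilin q1 q2 J n m.+2 u + bilin q1 q2 J n m.+1 u).
Proof.
move=> h1 h2; have [q20 q2S] := h2 n; have [_ q1S] := h1 n.
rewrite /bilin big_ord_recl /= [X in _ = X + _ + _]big_ord_recl /=.
rewrite [X in _ = _ + X + _]big_ord_recl /= -[in RHS]big_split /= mulr_sumr.
rewrite !addn0 q20 q1S.
under eq_bigr => i _ do rewrite q2S addSn q1S addnS.
rewrite mulrDl mulrDl -!addrA; congr (_ + _); rewrite addrCA; congr (_ + _).
rewrite -!big_split /=; apply: eq_bigr => i _.
rewrite !addSn !addnS exprS; ring.
Qed.

(** At [m = 0] the neighbour with index [-1] is the one with index [1] and the roles of [q1] and
    [q2] exchanged; the exchange disappears in [coefA] and in the symmetric sum [coefD]. *)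
Lemma bilinS0 (R : comNzRingType) (q1 q2 : nat -> nat -> R) J n (u : R) :
  pascal q1 -> pascal q2 ->
  bilin q1 q2 J.+1 n.+1 0 u =
  bilin q1 q2 J.+1 n 0 u + u * (bilin q1 q2 J n 1 u + bilin q2 q1 J n 1 u + bilin q1 q2 J n 0 u).
Proof.
move=> h1 h2; have [q20 q2S] := h2 n; have [q10 q1S] := h1 n.
rewrite /bilin big_ord_recl /= [X in _ = X + _]big_ord_recl /=.
rewrite -2!big_split /= mulr_sumr q10 q20 -addrA; congr (_ + _).
rewrite -big_split /=; apply: eq_bigr => i _.
rewrite !add0n !add1n q1S q2S exprS; ring.
Qed.

Definition bin (R : nzRingType) n i : R := 'C(n, i)%:R.
Arguments bin {R}.

Lemma pascal_bin (R : nzRingType) : pascal (@bin R).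
Proof. by move=> n; rewrite /bin !bin0; split=> // i; rewrite binS natrD. Qed.

Lemma pascal_dbin (R : realType) : pascal (@dbin R).
Proof. by move=> n; rewrite !dbin0r; split. Qed.

Lemma bilin_trunc (R : nzRingType) (q1 q2 : nat -> nat -> R) J n m (u : R) :
  q1 n (m + J)%N * q2 n J = 0 -> bilin q1 q2 J.+1 n m u = bilin q1 q2 J n m u.
Proof. by move=> h; rewrite /bilin big_ord_recr /= h mul0r addr0. Qed.

Lemma coefA_bilin (R : realType) n m (u : R) : coefA n m u = bilin bin bin n.+1 n m u.
Proof. by []. Qed.

Lemma coefD_bilin (R : realType) n m (u : R) :
  coefD n m u = bilin (@dbin R) bin n.+1 n m u + bilin bin (@dbin R) n.+1 n m u.
Proof. by rewrite /coefD /bilin -big_split /=; apply: eq_bigr => j _; rewrite mulrDl. Qed.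

Lemma bin_out (R : nzRingType) n m : @bin R n (m + n.+1) = 0.
Proof. by rewrite /bin bin_small //; lia. Qed.

(** Compares Fourier coefficients in [h ^ (n + 1) = h * h ^ n], with the scaling [(- t) ^ m]
    removed. *)
Lemma coefA_recS (R : realType) n m (u : R) : coefA n.+1 m.+1 u =
  (1 + u) * coefA n m.+1 u + coefA n m u + u * coefA n m.+2 u.
Proof.
rewrite !coefA_bilin bilinS; try exact: pascal_bin.
rewrite !(bilin_trunc (J := n.+1)); last 2 first.
- by rewrite bin_out mul0r.
- by rewrite bin_out mul0r.
ring.
Qed.

Lemma coefD_recS (R : realType) n m (u : R) : coefD n.+1 m.+1 u =
  (1 + u) * coefD n m.+1 u + coefD n m u + u * coefD n m.+2 u.
Proof.
have o := bin_out R n 0; rewrite add0n in o.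
rewrite !coefD_bilin !bilinS; try solve [exact: pascal_bin|exact: pascal_dbin].
rewrite !(bilin_trunc (J := n.+1)) ?bin_out ?o ?mul0r ?mulr0 //.
ring.
Qed.

Lemma coefA_rec0 (R : realType) n (u : R) : coefA n.+1 0 u =
  (1 + u) * coefA n 0 u + 2 * u * coefA n 1 u.
Proof.
rewrite !coefA_bilin bilinS0; try exact: pascal_bin.
rewrite !(bilin_trunc (J := n.+1)); last by rewrite bin_out mul0r.
ring.
Qed.

Lemma coefD_rec0 (R : realType) n (u : R) : coefD n.+1 0 u =
  (1 + u) * coefD n 0 u + 2 * u * coefD n 1 u.
Proof.
have o := bin_out R n 0; rewrite add0n in o.
rewrite !coefD_bilin !bilinS0; try solve [exact: pascal_bin|exact: pascal_dbin].
rewrite !(bilin_trunc (J := n.+1)) ?add0n ?o ?mul0r ?mulr0 //.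
ring.
Qed.

Lemma mul_bin_diagR (R : realType) n i :
  i.+1%:R * 'C(n.+1, i.+1)%:R = n.+1%:R * 'C(n, i)%:R :> R.
Proof. by rewrite -!natrM -mul_bin_diag. Qed.

(** Fourier form of [d/dg h ^ (n + 1) = (n + 1) h ^ n * 2 t sin g]; this is the relation that raises
    [mu]. *)
Lemma coefA_rec_diag (R : realType) n m (u : R) :
  m.+1%:R * coefA n.+1 m.+1 u = n.+1%:R * (coefA n m u - u * coefA n m.+2 u).
Proof.
have -> : coefA n m u = bilin bin bin n.+2 n m u.
  by rewrite (bilin_trunc (J := n.+1)) // bin_out mul0r.
rewrite /coefA /bilin [in RHS]big_ord_recl /= big_ord_recl /= /bin !addn0.
rewrite [u * _]mulr_sumr -addrA -sumrB mulrDr [in RHS]mulrDr; congr (_ + _).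
  by rewrite expr0 !mulr1 !bin0 !mulr1 mul_bin_diagR.
rewrite !mulr_sumr.
apply: eq_bigr => i _ /=.
(* The splitting lets the diagonal relation act on each of the two binomials separately. *)
have e : m.+1%:R = (m.+1 + i.+1)%:R - i.+1%:R :> R by rewrite natrD; ring.
rewrite e addSn; have h1 := mul_bin_diagR R n (m + i.+1); have h2 := mul_bin_diagR R n i.
transitivity ((((m + i.+1).+1%:R * 'C(n.+1, (m + i.+1).+1)%:R) * 'C(n.+1, i.+1)%:R
   - 'C(n.+1, (m + i.+1).+1)%:R * (i.+1%:R * 'C(n.+1, i.+1)%:R)) * u ^+ i.+1); first by ring.
by rewrite h1 h2 !binS !addSn !addnS exprS !natrD; ring.
Qed.

(** Derivative in [n] of [coefA_rec_diag]; the derivative of the factor [n + 1] is rewritten by that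
    relation as the [coefA] term. *)
Lemma coefD_rec_diag (R : realType) n m (u : R) :
  m.+1%:R * (coefD n.+1 m.+1 u - coefA n.+1 m.+1 u / n.+1%:R)
   = n.+1%:R * (coefD n m u - u * coefD n m.+2 u).
Proof.
have n0 : n.+1%:R != 0 :> R by rewrite pnatr_eq0.
have o := bin_out R n 0; rewrite add0n in o.
rewrite mulrBr mulrA coefA_rec_diag mulrAC mulfV // mul1r; apply/eqP.
rewrite subr_eq; apply/eqP.
have -> : coefD n m u = bilin (@dbin R) bin n.+2 n m u + bilin bin (@dbin R) n.+2 n m u.
  by rewrite coefD_bilin !(bilin_trunc (J := n.+1)) ?bin_out ?o ?mul0r ?mulr0.
have -> : coefA n m u = bilin bin bin n.+2 n m u.
  by rewrite (bilin_trunc (J := n.+1)) // bin_out mul0r.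
rewrite /coefD /coefA /bilin -big_split /= [in RHS]big_ord_recl /= big_ord_recl /= /bin !addn0.
rewrite [X in _ = _ + (X - _)]big_ord_recl /= !addn0.
have -> (F G G' A B C : R) : n.+1%:R * (F + G - A) + (B + G' - C) =
  (n.+1%:R * F + B) + (n.+1%:R * (G - A) + (G' - C)) by ring.
rewrite mulrDr; congr (_ + _).
  rewrite expr0 !mulr1 !bin0 !mulr1 !dbin0r !mulr0 !addr0.
  by rewrite mul_dbin_diag addrC.
rewrite !mulr_sumr -!sumrB mulr_sumr -big_split /=.
apply: eq_bigr => i _ /=.
have e : m.+1%:R = (m.+1 + i.+1)%:R - i.+1%:R :> R by rewrite natrD; ring.
rewrite /bump leq0n add1n e addSn.
have h1 := mul_bin_diagR R n (m + i.+1); have h2 := mul_bin_diagR R n i.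
have h3 := mul_dbin_diag R n (m + i.+1); have h4 := mul_dbin_diag R n i.
transitivity ((((m + i.+1).+1%:R * dbin R n.+1 (m + i.+1).+1) * 'C(n.+1, i.+1)%:R
   - dbin R n.+1 (m + i.+1).+1 * (i.+1%:R * 'C(n.+1, i.+1)%:R)
   + ((m + i.+1).+1%:R * 'C(n.+1, (m + i.+1).+1)%:R) * dbin R n.+1 i.+1
   - 'C(n.+1, (m + i.+1).+1)%:R * (i.+1%:R * dbin R n.+1 i.+1)) * u ^+ i.+1).
  by rewrite add0n !dbinS; ring.
by rewrite h1 h2 h3 h4 !binS !dbinS !addSn !addnS exprS !natrD; ring.
Qed.

Lemma coefA0 (R : realType) m (u : R) : coefA 0 m u = (m == 0%N)%:R.
Proof. by rewrite /coefA big_ord1 addn0 bin0n bin0 expr0 !mulr1. Qed.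

Lemma coefD0 (R : realType) m (u : R) : coefD 0 m u = dbin R 0 m.
Proof. by rewrite /coefD big_ord1 addn0 bin0 expr0 dbin0r mulr0 addr0 !mulr1. Qed.

Lemma coef_bounded (R : realType) n (u : R) : 0 <= u -> exists2 C, 0 <= C &
  forall m, `|coefA n m u| <= C /\ `|coefD n m u| <= C.
Proof.
move=> u0.
pose C := \sum_(j < n.+1) (2 ^+ n * 2 ^+ n + 2 ^+ n * 2 ^+ n) * u ^+ j : R.
have P0 : 0 <= 2 ^+ n * 2 ^+ n :> R by rewrite mulr_ge0 ?exprn_ge0.
have ple (a b : R) : `|a| <= 2 ^+ n -> `|b| <= 2 ^+ n -> `|a * b| <= 2 ^+ n * 2 ^+ n.
  by move=> ha hb; rewrite normrM ler_pM.
exists C => [|m].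
  by apply: sumr_ge0 => j _; rewrite mulr_ge0 ?exprn_ge0 // addr_ge0.
split; rewrite (le_trans (ler_norm_sum _ _ _)) //; apply: ler_sum => j _;
  rewrite normrM [`|u ^+ j|]ger0_norm ?exprn_ge0 // ler_wpM2r ?exprn_ge0 //.
  rewrite (le_trans (ple _ _ (binomial_bound _ _ _) (binomial_bound _ _ _))) //.
  by rewrite lerDl.
rewrite (le_trans (ler_normD _ _)) // lerD //.
  by apply: ple; rewrite ?dbin_bound ?binomial_bound.
by apply: ple; rewrite ?dbin_bound ?binomial_bound.
Qed.

(** * Gegenbauer and Chebyshev polynomials *)

Lemma pochhammerSr (R : realType) (a : R) n :
  pochhammer a n.+1 = pochhammer a n * (a + n%:R).
Proof. by rewrite /pochhammer big_ord_recr. Qed.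

Lemma pochhammerSl (R : realType) (a : R) n :
  pochhammer a n.+1 = a * pochhammer (a + 1) n.
Proof.
rewrite /pochhammer big_ord_recl addr0; congr (_ * _).
by apply: eq_bigr => i _; rewrite /= /bump leq0n natrD addrA.
Qed.

Lemma pochhammer_nat (R : realType) m n :
  pochhammer m.+1%:R n = (m + n)`!%:R / m`!%:R :> R.
Proof.
elim: n => [|n IH]; first by rewrite /pochhammer big_ord0 addn0 divff // natf_neq0.
rewrite pochhammerSr IH addnS factS (natrM _ (m + n).+1) -natrD addSn; ring.
Qed.

Lemma horner_gegenbauer (R : realType) l (lam y : R) : (gegenbauer l lam).[y] =
  \sum_(j < l./2.+1) (-1) ^+ j * pochhammer lam (l - j) / (j`! * (l - j.*2)`!)%:R
    * (2 * y) ^+ (l - j.*2).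
Proof.
rewrite /gegenbauer big_mkord horner_sum; apply: eq_bigr => j _.
by rewrite hornerZ horner_exp hornerZ hornerX.
Qed.

Lemma gegenbauer_connect (R : realType) l (lam y : R) :
  (l.+2%:R + lam) * (gegenbauer l.+2 lam).[y] =
  lam * ((gegenbauer l.+2 (lam + 1)).[y] - (gegenbauer l (lam + 1)).[y]).
Proof.
rewrite !horner_gegenbauer (_ : l.+2./2 = l./2.+1) //.
(* The degree of [gegenbauer l] is lower by two, so its term [j] pairs with term [j.+1] of the other
   two polynomials. *)
rewrite big_ord_recl [X in _ = _ * (X - _)]big_ord_recl.
rewrite [LHS]mulrDr -[in RHS]addrA [RHS]mulrDr; congr (_ + _).
  have P : lam * pochhammer (lam + 1) l.+2 = (l.+2%:R + lam) * pochhammer lam l.+2.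
    by rewrite -pochhammerSl pochhammerSr mulrC addrC.
  by rewrite !expr0 !subn0 !mul1r !mulrA P.
rewrite -sumrB !mulr_sumr; apply: eq_bigr => j _.
have lej : (j.*2 <= l)%N by have := ltn_ord j; lia.
rewrite lift0 doubleS.
have -> : (l.+2 - j.+1 = (l - j).+1)%N by lia.
have -> : (l.+2 - j.*2.+2 = l - j.*2)%N by lia.
rewrite pochhammerSl [pochhammer (lam + 1) _.+1]pochhammerSr factS !natrM exprS.
have -> : (l - j)%:R = l%:R - j%:R :> R by rewrite natrB //; lia.
have h0 : j.+1%:R != 0 :> R by rewrite pnatr_eq0.
move: (natf_neq0 R j) (natf_neq0 R (l - j.*2)).
move: (pochhammer _ _) ((2 * y) ^+ _) ((-1) ^+ _) (j`!%:R) ((l - j.*2)`!%:R) => P Y s a b ha hb.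
rewrite -[l.+2%:R]natr1 -[l.+1%:R]natr1.
by field; rewrite ha hb nat1r h0.
Qed.

Lemma gegenbauer_connect_small (R : realType) l (lam y : R) : (l < 2)%N ->
  (l%:R + lam) * (gegenbauer l lam).[y] = lam * (gegenbauer l (lam + 1)).[y].
Proof.
rewrite !horner_gegenbauer; case: l => [|[|//]] _; rewrite !big_ord1 !subn0.
  rewrite [nat_of_ord ord0]/= /pochhammer !big_ord0 !expr0 (_ : 0`! * 0`! = 1)%N //.
  ring.
rewrite [nat_of_ord ord0]/= !pochhammerSl /pochhammer !big_ord0 !expr0.
by rewrite (_ : 0`! * 1`! = 1)%N //; ring.
Qed.

(** The free length [N] aligns the sums of different degrees: past [l./2] the binomial vanishes. *)
Lemma chebyshevUE (R : realType) l N (y : R) : (l./2 < N)%N ->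
  (gegenbauer l 1).[y] = \sum_(j < N) (-1) ^+ j * 'C(l - j, j)%:R * (2 * y) ^+ (l - j.*2).
Proof.
move=> ltN; rewrite horner_gegenbauer.
rewrite (big_ord_widen N (fun j => (-1) ^+ j * pochhammer 1 (l - j) /
  (j`! * (l - j.*2)`!)%:R * (2 * y) ^+ (l - j.*2))) // big_mkcond /=.
apply: eq_bigr => j _; case: ifPn => [lt|]; last first.
  by rewrite -leqNgt => lt; rewrite bin_small ?mulr0 ?mul0r //; lia.
rewrite binomialE; last by lia.
have -> : pochhammer (1 : R) (l - j) = (l - j)`!%:R.
  by have := pochhammer_nat R 0 (l - j); rewrite fact0 divr1 add0n.
by rewrite natrM !mulrA; have -> : (l - j - j = l - j.*2)%N by lia.
Qed.

Lemma chebyshevU_rec (R : realType) l (y : R) :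
  (gegenbauer l.+2 1).[y] = 2 * y * (gegenbauer l.+1 1).[y] - (gegenbauer l 1).[y].
Proof.
rewrite (@chebyshevUE _ l.+2 l./2.+2) // (@chebyshevUE _ l.+1 l./2.+2); last by lia.
rewrite (@chebyshevUE _ l l./2.+1) // big_ord_recl [X in _ = _ * X - _]big_ord_recl.
rewrite mulrDr -[in RHS]addrA; congr (_ + _).
  by rewrite !bin0 !subn0 !expr0 !mul1r exprS.
rewrite mulr_sumr -sumrB; apply: eq_bigr => j _.
have lej : (j.*2 <= l)%N by have := ltn_ord j; lia.
rewrite lift0 doubleS.
have -> : (l.+1 - j.+1 = l - j)%N by lia.
have -> : (l.+2 - j.+1 = (l - j).+1)%N by lia.
have -> : (l.+2 - j.*2.+2 = l - j.*2)%N by lia.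
rewrite binS natrD.
move: lej; rewrite leq_eqVlt => /orP[/eqP e|lt].
  have -> : 'C(l - j, j.+1) = 0%N by rewrite bin_small //; lia.
  by rewrite exprS; ring.
have -> : (l - j.*2 = (l.+1 - j.*2.+2).+1)%N by lia.
rewrite !exprS; ring.
Qed.

Lemma cos_rec (R : realType) (g : R) l :
  cos (l.+2%:R * g) = 2 * cos g * cos (l.+1%:R * g) - cos (l%:R * g).
Proof.
have -> : l.+2%:R * g = l.+1%:R * g + g by rewrite -[l.+2%:R]natr1; ring.
have -> : l%:R * g = l.+1%:R * g - g by rewrite -[l.+1%:R]natr1; ring.
by rewrite cosD cosB; ring.
Qed.

(** The connection formula in the limit [mu -> 0]. Both sides satisfy the three-term recursion of
    [cos_rec]. *)
Lemma chebyshevU_cos (R : realType) l (g : R) :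
  (gegenbauer l.+2 1).[cos g] - (gegenbauer l 1).[cos g] = 2 * cos (l.+2%:R * g).
Proof.
have U0 : (gegenbauer 0 1).[cos g] = 1.
  by rewrite (@chebyshevUE _ 0 1) // big_ord1 !expr0 bin0 !mulr1.
have U1 : (gegenbauer 1 1).[cos g] = 2 * cos g.
  by rewrite (@chebyshevUE _ 1 1) // big_ord1 !expr0 bin0 !mul1r expr1.
elim/ltn_ind: l => -[|[|l]] IH.
- by rewrite cos_rec !chebyshevU_rec U0 U1 mul1r mul0r cos0; ring.
- by rewrite !cos_rec !chebyshevU_rec U0 U1 mul1r mul0r cos0; ring.
rewrite cos_rec chebyshevU_rec [X in _ - X]chebyshevU_rec.
have h1 := IH l.+1 (ltnSn _); have h2 := IH l (ltnW (ltnSn _)).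
have -> : 2 * (2 * cos g * cos (l.+3%:R * g) - cos (l.+2%:R * g)) =
  2 * cos g * (2 * cos (l.+3%:R * g)) - 2 * cos (l.+2%:R * g) by ring.
by rewrite -h1 -h2; ring.
Qed.

(* [gegs mu l = Gamma(mu) C_l^mu]; the connection formula then reads
   [hcosW mu l = gegs mu.+1 l - gegs mu.+1 (l - 2)] uniformly in [mu >= 0]. *)
Definition gegs (R : realType) (mu l : nat) (y : R) : R :=
  mu.-1`!%:R * (gegenbauer l mu%:R).[y].

(** The case [mu = 0] is the limit of [(l + mu) Gamma(mu) C_l^mu(cos g)] as [mu -> 0]. *)
Definition hcosW (R : realType) (g : R) (mu l : nat) : R :=
  if mu is 0 then (if l is 0 then 1 else 2 * cos (l%:R * g))
  else (l + mu)%:R * gegs mu l (cos g).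

Lemma hcosW_small (R : realType) (g : R) mu l : (l < 2)%N ->
  hcosW g mu l = gegs mu.+1 l (cos g).
Proof.
case: mu => [|mu] lt /=.
  rewrite /gegs /= mul1r; case: l lt => [|[|//]] _.
    by rewrite (@chebyshevUE _ 0 1) // big_ord1 !expr0 bin0 !mulr1.
  by rewrite (@chebyshevUE _ 1 1) // big_ord1 !expr0 bin0 !mul1r expr1.
rewrite /gegs /= natrD mulrCA gegenbauer_connect_small // natr1.
by rewrite factS natrM; ring.
Qed.

Lemma hcosW_SS (R : realType) (g : R) mu l :
  hcosW g mu l.+2 = gegs mu.+1 l.+2 (cos g) - gegs mu.+1 l (cos g).
Proof.
case: mu => [|mu].
  by rewrite /hcosW /gegs /= !mul1r chebyshevU_cos.
rewrite /hcosW /gegs /= natrD mulrCA gegenbauer_connect natr1.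
by rewrite factS natrM; ring.
Qed.

(** * Growth bounds and the passage to the limit *)

Lemma bernoulli_pow (R : realType) (x : R) n : 0 <= x -> 1 + n%:R * x <= (1 + x) ^+ n.
Proof.
move=> x0; elim: n => [|n IH]; first by rewrite mul0r addr0 expr0.
rewrite exprS (le_trans _ (ler_wpM2l _ IH)) ?addr_ge0 //.
rewrite -natr1; have : 0 <= n%:R * x * x by rewrite !mulr_ge0.
lra.
Qed.

Lemma linear_le_exp (R : realType) (rho : R) k : 1 < rho ->
  exists2 D, 0 <= D & forall l, (l + k)%:R <= D * rho ^+ l.
Proof.
move=> r1; have d0 : 0 < rho - 1 by rewrite subr_gt0.
exists ((rho - 1)^-1 + k%:R); first by rewrite addr_ge0 // invr_ge0 ltW.
move=> l; rewrite natrD mulrDl lerD //.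
  rewrite mulrC ler_pdivlMr //.
  have := bernoulli_pow l (ltW d0); have -> : 1 + (rho - 1) = rho by ring.
  by apply: le_trans; rewrite lerDr.
by rewrite ler_peMr // exprn_ege1 // ltW.
Qed.

(** Undoes the difference with step two. The new constant [D'] solves
    [D' + D * rho ^ 2 = D' * rho ^ 2], which closes the induction from [l] to [l + 2]. *)
Lemma gegs_le_hcosW (R : realType) (g : R) mu D (rho : R) : 1 < rho -> 0 <= D ->
  (forall l, `|hcosW g mu l| <= D * rho ^+ l) ->
  forall l, `|gegs mu.+1 l (cos g)| <= D * rho ^+ 2 / (rho ^+ 2 - 1) * rho ^+ l.
Proof.
move=> r1 D0 hD; set D' := _ / _.
have rho0 : 0 <= rho by rewrite (le_trans ler01) // ltW.
have r2 : 0 < rho ^+ 2 - 1 by rewrite subr_gt0 exprn_egt1.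
have DD' : D' * (rho ^+ 2 - 1) = D * rho ^+ 2 by rewrite /D' divfK // gt_eqF.
have D'0 : 0 <= D' by rewrite /D' divr_ge0 ?mulr_ge0 ?exprn_ge0 ?(ltW r2).
have leD : D <= D' by rewrite /D' ler_pdivlMr // mulrBr mulr1 gerBl.
elim/ltn_ind => l IH; case: (ltnP l 2) => lt.
  by rewrite -hcosW_small // (le_trans (hD _)) // ler_wpM2r // exprn_ge0.
case: l lt IH => [|[|l]] // _ IH.
have -> : gegs mu.+1 l.+2 (cos g) = gegs mu.+1 l (cos g) + hcosW g mu l.+2.
  by rewrite hcosW_SS; ring.
rewrite (le_trans (ler_normD _ _)) // (le_trans (lerD (IH l (ltnW (ltnSn _))) (hD _))) //.
have -> : rho ^+ l.+2 = rho ^+ 2 * rho ^+ l by rewrite -exprD.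
have -> : D' * (rho ^+ 2 * rho ^+ l) = D' * rho ^+ l + D' * (rho ^+ 2 - 1) * rho ^+ l by ring.
by rewrite DD' mulrA.
Qed.

Lemma hcosW_bound (R : realType) (g : R) mu (rho : R) : 1 < rho ->
  exists2 D, 0 <= D & forall l, `|hcosW g mu l| <= D * rho ^+ l.
Proof.
elim: mu rho => [|mu IH] rho r1.
  exists 2 => // -[|l].
    by rewrite normr1 expr0 mulr1 ler1n.
  rewrite /hcosW normrM normr_nat ler_pM // (@le_trans _ _ 1) //.
    by rewrite ler_norml cos_geN1 cos_le1.
  by rewrite exprn_ege1 // ltW.
(* One factor [sqrt rho] pays for the linear weight [l + mu], the other for the Gegenbauer value. *)
have s1 : 1 < Num.sqrt rho by rewrite -[1]sqrtr1 ltr_sqrt // (lt_trans ltr01).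
have [D D0 hD] := IH _ s1.
have [E E0 hE] := linear_le_exp mu.+1 s1.
have hG := gegs_le_hcosW s1 D0 hD.
set D' := _ / _ in hG.
have D'0 : 0 <= D' by have := hG 0%N; rewrite expr0 mulr1; apply: le_trans.
exists (E * D'); first by rewrite mulr_ge0.
move=> l; rewrite /hcosW normrM normr_nat.
have -> : E * D' * rho ^+ l = (E * Num.sqrt rho ^+ l) * (D' * Num.sqrt rho ^+ l).
  have {1}-> : rho = Num.sqrt rho * Num.sqrt rho.
    by rewrite -expr2 sqr_sqrtr // ltW // (lt_trans ltr01).
  by rewrite exprMn; ring.
by rewrite ler_pM.
Qed.

Lemma gegs_bound (R : realType) (g : R) mu (rho : R) : 1 < rho ->
  exists2 D, 0 <= D & forall l, `|gegs mu.+1 l (cos g)| <= D * rho ^+ l.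
Proof.
move=> r1; have [D D0 hD] := hcosW_bound g mu r1.
have hG := gegs_le_hcosW r1 D0 hD; exists (D * rho ^+ 2 / (rho ^+ 2 - 1)) => //.
by have := hG 0%N; rewrite expr0 mulr1; apply: le_trans.
Qed.

(** Abel summation with step two, hence two boundary terms. *)
Lemma sum_hcosW (R : realType) (g : R) mu (e : nat -> R) N :
  \sum_(l < N.+2) e l * hcosW g mu l =
  \sum_(l < N.+2) (e l - e l.+2) * gegs mu.+1 l (cos g)
  + (e N.+2 * gegs mu.+1 N (cos g) + e N.+3 * gegs mu.+1 N.+1 (cos g)).
Proof.
elim: N => [|N IH].
  rewrite !big_ord_recr !big_ord0 /= !hcosW_small //; ring.
by rewrite big_ord_recr /= IH [in RHS]big_ord_recr /= hcosW_SS; ring.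
Qed.

Local Open Scope classical_set_scope.

Lemma cvg0_geometric (R : realType) (a : nat -> R) (C s : R) : 0 <= s -> s < 1 ->
  (forall n, `|a n| <= C * s ^+ n) -> a n @[n --> \oo] --> (0 : R).
Proof.
move=> s0 s1 ha; apply/norm_cvg0P.
apply: (@squeeze_cvgr _ _ _ _ (fun=> 0) (fun n => C * s ^+ n)).
- by near=> n; rewrite normr_ge0 /=.
- exact: cvg_cst.
rewrite -[X in _ --> X](mulr0 C); apply: cvgMl_tmp.
by apply: cvg_expr; rewrite ger0_norm.
Unshelve. all: by end_near.
Qed.

Lemma cvg_partial_sum2 (R : realType) (F G : nat -> R) (b : nat -> R) (f : R) :
  (forall N, \sum_(l < N.+2) F l = \sum_(l < N.+2) G l + b N) ->
  b n @[n --> \oo] --> (0 : R) ->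
  (\sum_(l < n) F l) @[n --> \oo] --> f -> (\sum_(l < n) G l) @[n --> \oo] --> f.
Proof.
move=> FG b0; rewrite -(cvg_shiftn 2) -[in X in _ -> X](cvg_shiftn 2) => cF.
have -> : [sequence \sum_(l < n + 2) G l]_n = (fun n => \sum_(l < n + 2) F l - b n).
  by apply/funext => n /=; rewrite addn2 FG addrK.
by rewrite -[f]subr0; apply: cvgB.
Qed.

Lemma expansion_mu_step (R : realType) (g t C f : R) (mu : nat) (e e' : nat -> R) :
  0 < t -> t < 1 -> (forall l, `|e l| <= C * t ^+ l) ->
  (forall l, e l - e l.+2 = (l + mu).+1%:R * e' l) ->
  (\sum_(l < n) e l * hcosW g mu l) @[n --> \oo] --> f ->
  (\sum_(l < n) e' l * hcosW g mu.+1 l) @[n --> \oo] --> f.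
Proof.
move=> t0 t1 eC ee' ef; refine (@cvg_partial_sum2 _ (fun l => e l * hcosW g mu l) (fun l => e' l * hcosW g mu.+1 l) (fun N =>
  e N.+2 * gegs mu.+1 N (cos g) + e N.+3 * gegs mu.+1 N.+1 (cos g)) _ _ _ ef) => [N|].
  rewrite sum_hcosW; congr (_ + _); apply: eq_bigr => l _.
  by rewrite ee' /= addnS; ring.
have C0 : 0 <= C by have := eC 0%N; rewrite expr0 mulr1; apply: le_trans.
(* Midpoint of [1] and [1 / t]: the growth rate exceeds [1], yet [t * rho < 1] makes the boundary
   terms vanish in the limit. *)
pose rho := (t^-1 + 1) / 2.
have tV : 1 < t^-1 by rewrite invf_gt1.
have rho1 : 1 < rho by rewrite /rho; lra.
have [D D0 hD] := gegs_bound g mu rho1.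
have trho : t * rho = (1 + t) / 2 by rewrite /rho; field; rewrite gt_eqF.
have step : e n.+2 * gegs mu.+1 n (cos g) @[n --> \oo] --> (0 : R).
  apply: (@cvg0_geometric _ _ (C * t ^+ 2 * D) (t * rho)).
  - by rewrite trho; lra.
  - by rewrite trho; lra.
  move=> n; rewrite normrM.
  have -> : C * t ^+ 2 * D * (t * rho) ^+ n = (C * t ^+ n.+2) * (D * rho ^+ n).
    by rewrite exprMn -(addn2 n) exprD; ring.
  by rewrite ler_pM.
rewrite -[X in _ --> X](addr0 0); apply: cvgD; first exact: step.
by rewrite -cvg_shiftS in step.
Qed.

(** By the product formula for cosines. The factor 2 in the condition at index 0 arises because
    [hcosW] weights index 0 by 1 and all others by 2. *)
Lemma sum_hcosW0_mul (R : realType) (g t : R) (c c' : nat -> R) N :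
  c' 0%N = (1 + t ^+ 2) * c 0%N - 2 * t * c 1%N ->
  (forall l, c' l.+1 = (1 + t ^+ 2) * c l.+1 - t * (c l + c l.+2)) ->
  (1 - 2 * t * cos g + t ^+ 2) * \sum_(l < N.+1) c l * hcosW g 0 l =
  \sum_(l < N.+1) c' l * hcosW g 0 l
  + (t * c N.+1 * (2 * cos (N%:R * g)) - t * c N * (2 * cos (N.+1%:R * g))).
Proof.
move=> c0 cS; elim: N => [|N IH].
  by rewrite !big_ord1 /= c0 mul0r cos0 mul1r; ring.
rewrite big_ord_recr /= mulrDr IH [in RHS]big_ord_recr /= cS cos_rec; ring.
Qed.

Lemma expansion_p_step (R : realType) (g t C f : R) (c c' : nat -> R) :
  0 < t -> t < 1 -> (forall l, `|c l| <= C * t ^+ l) ->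
  c' 0%N = (1 + t ^+ 2) * c 0%N - 2 * t * c 1%N ->
  (forall l, c' l.+1 = (1 + t ^+ 2) * c l.+1 - t * (c l + c l.+2)) ->
  (\sum_(l < n) c l * hcosW g 0 l) @[n --> \oo] --> f ->
  (\sum_(l < n) c' l * hcosW g 0 l) @[n --> \oo] --> (1 - 2 * t * cos g + t ^+ 2) * f.
Proof.
move=> t0 t1 cC c0 cS cf.
have C0 : 0 <= C by have := cC 0%N; rewrite expr0 mulr1; apply: le_trans.
pose h := 1 - 2 * t * cos g + t ^+ 2.
refine (@cvg_partial_sum2 _ (fun l => h * (c l * hcosW g 0 l))
  (fun l => c' l * hcosW g 0 l) (fun N =>
  t * c N.+2 * (2 * cos (N.+1%:R * g)) - t * c N.+1 * (2 * cos (N.+2%:R * g))) _ _ _ _).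
- by move=> N; rewrite -mulr_sumr (sum_hcosW0_mul _ _ c0 cS).
- apply: (@cvg0_geometric _ _ (4 * C) t); rewrite ?(ltW t0) // => n.
  have bd (x y : R) : `|x| <= C * t ^+ n -> `|t * x * (2 * cos y)| <= 2 * C * t ^+ n.
    move=> hx; rewrite !normrM (ger0_norm (ltW t0)) normr_nat.
    have hc : `|cos y| <= 1 by rewrite ler_norml cos_geN1 cos_le1.
    have : t * `|x| <= 1 * (C * t ^+ n) by rewrite ler_pM // ltW.
    rewrite mul1r => h1.
    have : t * `|x| * `|cos y| <= C * t ^+ n * 1.
      by rewrite ler_pM // mulr_ge0 // ltW.
    by lra.
  have mono k : C * t ^+ (n + k) <= C * t ^+ n.
    by rewrite ler_wpM2l // ler_wiXn2l ?(ltW t0) ?(ltW t1) // leq_addr.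
  rewrite (le_trans (ler_normB _ _)) //.
  have -> : 4 * C * t ^+ n = 2 * C * t ^+ n + 2 * C * t ^+ n by ring.
  rewrite lerD // bd // (le_trans (cC _)) //.
    by rewrite -(addn2 n) mono.
  by rewrite -(addn1 n) mono.
have -> : (fun n => \sum_(l < n) h * (c l * hcosW g 0 l)) =
   (fun n => h * \sum_(l < n) (c l * hcosW g 0 l)).
  by apply/funext => n; rewrite mulr_sumr.
exact: cvgMl_tmp.
Qed.

(** * Expansion of the logarithm and of its products with powers *)

Lemma quad_lb (R : realType) (g s : R) : 0 <= s -> (1 - s) ^+ 2 <= 1 - 2 * s * cos g + s ^+ 2.
Proof.
move=> s0; have : 0 <= 2 * s * (1 - cos g) by rewrite !mulr_ge0 // subr_ge0 cos_le1.
by rewrite expr2; nra.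
Qed.

(** Real part of a finite geometric sum in [s * e^(i g)], with the denominator cleared. *)
Lemma sum_cos_pow (R : realType) (g s : R) L :
  (1 - 2 * s * cos g + s ^+ 2) * \sum_(l < L) s ^+ l * cos (l.+1%:R * g) =
  cos g - s - s ^+ L * cos (L.+1%:R * g) + s ^+ L.+1 * cos (L%:R * g).
Proof.
elim: L => [|L IH]; first by rewrite big_ord0 mul0r cos0 [1 * g]mul1r; ring.
rewrite big_ord_recr /= mulrDr IH cos_rec !exprS; ring.
Qed.

(** Here [(-1) ^ l * dbin R 0 l = - 1 / l] for [l > 0]. The remainder [F L] vanishes at [0], and its
    derivative on [[0, t]] is of size [t ^ L]. *)
Lemma log_cos_expansion (R : realType) (g t kap : R) : 0 < t -> t < 1 ->
  (\sum_(l < n) ((-1) ^+ l * t ^+ l * (dbin R 0 l + kap * (l == 0 :> nat)%:R)) * hcosW g 0 l)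
    @[n --> \oo] --> ln (1 - 2 * t * cos g + t ^+ 2) + kap.
Proof.
move=> t0 t1.
pose h (s : R) := 1 - 2 * s * cos g + s ^+ 2 : R.
have h0 (s : R) : 0 <= s -> s <= t -> 0 < h s.
  move=> s0 st; apply: lt_le_trans (quad_lb g s0).
  by rewrite exprn_gt0 // subr_gt0 (le_lt_trans st).
pose S (L : nat) (s : R) := \sum_(l < L) (2 * cos (l.+1%:R * g) / l.+1%:R) * s ^+ l.+1 : R.
pose S' (L : nat) (s : R) := \sum_(l < L) (2 * cos (l.+1%:R * g)) * s ^+ l : R.
have dS (L : nat) (s : R) : is_derive s (1 : R) (S L) (S' L s).
  pose P : {poly R} := \sum_(l < L) (2 * cos (l.+1%:R * g) / l.+1%:R) *: 'X^(l.+1).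
  have -> : S L = horner P.
    by apply/funext => y; rewrite /P horner_sum; apply: eq_bigr => l _; rewrite hornerZ hornerXn.
  have -> : S' L s = P^`().[s]; last exact: is_derive_poly.
  rewrite /P raddf_sum horner_sum; apply: eq_bigr => l _ /=.
  rewrite derivZ derivXn hornerZ hornerMn hornerXn -mulr_natr /=.
  have ne : l.+1%:R != 0 :> R by rewrite pnatr_eq0.
  by field; rewrite nat1r ne.
have dh (s : R) : is_derive s (1 : R) h (2 * s - 2 * cos g).
  pose P : {poly R} := 1 - (2 * cos g) *: 'X + 'X^2.
  have -> : h = horner P by apply/funext => y; rewrite /P !hornerE /h; ring.
  have -> : 2 * s - 2 * cos g = P^`().[s]; last exact: is_derive_poly.
  rewrite /P derivD derivB derivXn derivZ derivX -['X^_]/('X) derivC sub0r.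
  by rewrite hornerD hornerN hornerZ hornerMn hornerX hornerC; ring.
pose F (L : nat) (s : R) := ln (h s) + S L s.
have dF (L : nat) (s : R) : 0 <= s -> s <= t -> is_derive s 1 (F L) ((h s)^-1 * (2 * s - 2 * cos g) + S' L s).
  move=> s0 st; apply: is_deriveD; apply: (@is_derive1_comp _ (@ln R) h).
  exact/is_derive1_ln/h0.
have bound (L : nat) : `|F L t| <= 4 / (1 - t) ^+ 2 * t ^+ L.
  have h0E : F L 0 = 0.
    rewrite /F /S /h mulr0 mul0r expr0n subr0 addr0 ln1 add0r big1 // => i _.
    by rewrite expr0n mulr0.
  have dFin x : x \in `]0, t[%R ->
      is_derive x (1 : R) (F L) ((h x)^-1 * (2 * x - 2 * cos g) + S' L x).
    by rewrite in_itv /= => /andP[/ltW x0 /ltW xt]; exact: dF.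
  have [|x + E] := @MVT R (F L) _ 0 t t0 dFin.
    apply: derivable_within_continuous => x; rewrite in_itv /= => /andP[x0 xt].
    by have [] := dF L x x0 xt.
  rewrite in_itv /= => /andP[/ltW x0 /ltW xt].
  move: E; rewrite h0E !subr0 => ->.
  have hx := h0 x x0 xt.
  (* The derivative of [ln h] cancels against the closed part of the cosine sum, so that only the
     two boundary terms of [sum_cos_pow] remain. *)
  have -> : (h x)^-1 * (2 * x - 2 * cos g) + S' L x =
     2 * (h x)^-1 * (x ^+ L.+1 * cos (L%:R * g) - x ^+ L * cos (L.+1%:R * g)).
    have := sum_cos_pow g x L; rewrite -/(h x).
    have -> : S' L x = 2 * \sum_(l < L) x ^+ l * cos (l.+1%:R * g).
      by rewrite mulr_sumr; apply: eq_bigr => l _; ring.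
    set s := \sum_(l < L) _ => E.
    have -> : x ^+ L.+1 * cos (L%:R * g) - x ^+ L * cos (L.+1%:R * g) =
      h x * s - cos g + x by rewrite E; ring.
    by field; rewrite gt_eqF.
  have pw k : x ^+ (L + k) <= t ^+ L.
    rewrite (@le_trans _ _ (x ^+ L)) ?lerXn2r ?nnegrE ?(ltW t0) //.
    by rewrite ler_wiXn2l ?leq_addr // (le_trans xt (ltW t1)).
  have bd k y : `|x ^+ (L + k) * cos y| <= t ^+ L.
    rewrite normrM -[t ^+ L]mulr1 ler_pM //.
      by rewrite ger0_norm ?exprn_ge0.
    by rewrite ler_norml cos_geN1 cos_le1.
  have b2 : `|x ^+ L.+1 * cos (L%:R * g) - x ^+ L * cos (L.+1%:R * g)| <= 2 * t ^+ L.
    rewrite (le_trans (ler_normB _ _)) // (_ : 2 * t ^+ L = t ^+ L + t ^+ L); last by ring.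
    by rewrite lerD // -?(addn1 L) ?bd // -[X in x ^+ X]addn0 bd.
  have hV : (h x)^-1 <= ((1 - t) ^+ 2)^-1.
    rewrite lef_pV2 ?posrE // ?exprn_gt0 ?subr_gt0 // (le_trans _ (quad_lb g x0)) //.
    by rewrite lerXn2r ?nnegrE ?subr_ge0 ?lerB // ltW // (le_lt_trans xt).
  have hV0 : 0 <= (h x)^-1 by rewrite invr_ge0 ltW.
  rewrite !normrM normr_nat (ger0_norm hV0) (ger0_norm (ltW t0)).
  have m1 := ler_pM hV0 (normr_ge0 _) hV b2.
  set a := _^-1 * `|_| in m1.
  have a0 : 0 <= a by rewrite mulr_ge0.
  have : a * t <= a * 1 by rewrite ler_wpM2l // ltW.
  rewrite mulr1 => m2.
  rewrite (_ : 2 * _^-1 * _ * t = 2 * (a * t)); last by rewrite /a !mulrA.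
  apply: (@le_trans _ _ (2 * a)); first by rewrite ler_wpM2l.
  rewrite [X in _ <= X](_ : _ = 2 * (((1 - t) ^+ 2)^-1 * (2 * t ^+ L))); last by ring.
  by rewrite ler_wpM2l.
have F0 : F n t @[n --> \oo] --> (0 : R).
  exact: (cvg0_geometric (ltW t0) t1 bound).
rewrite -cvg_shiftS.
have -> : [sequence \sum_(l < n.+1) ((-1) ^+ l * t ^+ l *
      (dbin R 0 l + kap * (l == 0 :> nat)%:R)) * hcosW g 0 l]_n =
   (fun n => ln (h t) + kap - F n t).
  apply/funext => n /=; rewrite big_ord_recl /F /= add0r !expr0 !mul1r !mulr1.
  rewrite [X in _ + X = _](_ : _ = - S n t); first by ring.
  rewrite /S -sumrN; apply: eq_bigr => l _; rewrite /= mulr0 addr0.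
  rewrite [(-1) ^+ l.+1]exprS.
  have s1 : (-1) ^+ l * (-1) ^+ l = 1 :> R by rewrite -expr2 sqrr_sign.
  transitivity (- ((-1) ^+ l * (-1) ^+ l * t ^+ l.+1 / l.+1%:R * (2 * cos (l.+1%:R * g)))).
    by ring.
  by rewrite s1; ring.
have cF := cvgB (cvg_cst (ln (h t) + kap)) F0.
by rewrite subr0 in cF; exact: cF.
Qed.

(* Apart from the prefactor, [mu] enters only through [p + mu] and [l + mu]. *)
Definition ecoef (R : realType) (kap t : R) (p mu l : nat) : R :=
  (-1) ^+ l * t ^+ l * (p`!%:R / (p + mu)`!%:R) *
  (coefD (p + mu) (l + mu) (t ^+ 2)
   + (kap - harm R (p + mu) + harm R p) * coefA (p + mu) (l + mu) (t ^+ 2)).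

Lemma ecoef_bound (R : realType) (kap t : R) p mu : 0 <= t ->
  exists C, forall l, `|ecoef kap t p mu l| <= C * t ^+ l.
Proof.
move=> t0; have [C C0 hC] := coef_bounded (p + mu) (exprn_ge0 2 t0).
pose k : R := kap - harm R (p + mu) + harm R p.
exists (p`!%:R / (p + mu)`!%:R * (C + `|k| * C)) => l.
have [hA hD] := hC (l + mu)%N.
rewrite /ecoef -/k !normrM normrX normrN1 expr1n mul1r normrX (ger0_norm t0).
rewrite normfV !normr_nat -mulrA mulrC ler_wpM2r ?exprn_ge0 //.
rewrite ler_wpM2l ?divr_ge0 // (le_trans (ler_normD _ _)) // lerD //.
by rewrite normrM ler_wpM2l.
Qed.

Lemma expansion_cos (R : realType) (kap g t : R) p : 0 < t -> t < 1 ->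
  (\sum_(l < n) ecoef kap t p 0 l * hcosW g 0 l) @[n --> \oo]
    --> (1 - 2 * t * cos g + t ^+ 2) ^+ p * (ln (1 - 2 * t * cos g + t ^+ 2) + kap).
Proof.
move=> t0 t1.
have eE q l : ecoef kap t q 0 l =
    (-1) ^+ l * t ^+ l * (coefD q l (t ^+ 2) + kap * coefA q l (t ^+ 2)).
  by rewrite /ecoef !addn0 divff ?natf_neq0 // mulr1 subrK.
elim: p => [|p IH].
  rewrite expr0 mul1r.
  have -> : (fun n : nat => \sum_(l < n) ecoef kap t 0 0 l * hcosW g 0 l) = (fun n : nat =>
     \sum_(l < n) ((-1) ^+ l * t ^+ l * (dbin R 0 l + kap * (l == 0 :> nat)%:R)) * hcosW g 0 l).
    by apply/funext => n; apply: eq_bigr => l _; rewrite eE coefA0 coefD0.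
  exact: log_cos_expansion.
have [C hC] := ecoef_bound kap p 0 (ltW t0).
rewrite exprS -mulrA; apply: (expansion_p_step t0 t1 hC _ _ IH).
  by rewrite !eE coefA_rec0 coefD_rec0; ring.
by move=> l; rewrite !eE coefA_recS coefD_recS !exprS expr0; ring.
Qed.

Lemma expansion (R : realType) (kap g t : R) p mu : 0 < t -> t < 1 ->
  (\sum_(l < n) ecoef kap t p mu l * hcosW g mu l) @[n --> \oo]
    --> (1 - 2 * t * cos g + t ^+ 2) ^+ p * (ln (1 - 2 * t * cos g + t ^+ 2) + kap).
Proof.
move=> t0 t1; elim: mu => [|mu IH]; first exact: expansion_cos.
have [C hC] := ecoef_bound kap p mu (ltW t0).
apply: (expansion_mu_step t0 t1 hC _ IH) => l.
rewrite /ecoef !addnS addSn; set n := (p + mu)%N; set m := (l + mu)%N; set u := t ^+ 2.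
(* The extra term [- coefA / (n + 1)] in [hD] is exactly the increment of [harm (p + mu)]. *)
have hA := coefA_rec_diag n m u; have hD := coefD_rec_diag n m u.
rewrite harmS factS (natrM _ n.+1).
have n0 : n.+1%:R != 0 :> R by rewrite pnatr_eq0.
have f0 := natf_neq0 R n.
transitivity ((-1) ^+ l * t ^+ l * (p`!%:R / (n.+1%:R * n`!%:R)) *
  (n.+1%:R * (coefD n m u - u * coefD n m.+2 u)
  + (kap - harm R n + harm R p) * (n.+1%:R * (coefA n m u - u * coefA n m.+2 u)))).
  have -> : m.+2 = (l.+2 + mu)%N by [].
  rewrite -[l.+2]addn2 !exprD -/u.
  move: n0 f0; move: (n.+1%:R) (n`!%:R) => x y x0 y0.
  by field; rewrite x0 y0.
rewrite -hA -hD; ring.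
Qed.

(** * The generating function of trinomial coefficients and its closed form *)

Lemma binomial_le_pow (R : realType) (w : R) M i : 0 <= w ->
  'C(M, i)%:R * w ^+ i <= (1 + w) ^+ M.
Proof.
move=> w0; have w1 : 0 <= 1 + w by rewrite addr_ge0.
elim: M i => [|M IH] [|i].
- by rewrite bin0 !expr0 mulr1.
- by rewrite bin0n mul0r ler01.
- by rewrite bin0 expr0 mulr1 exprn_ege1 // lerDl.
rewrite binS natrD mulrDl [(1 + w) ^+ _]exprS mulrDl mul1r lerD //.
by rewrite exprS mulrCA ler_wpM2l.
Qed.

(* The trinomial coefficient [(m + 2n + a)! / ((m + n)! n! a!)]. *)
Definition trinom (m a n : nat) : nat := ('C(m + n.*2 + a, a) * 'C(m + n.*2, n))%N.

Lemma trinom00 m : trinom m 0 0 = 1%N.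
Proof. by rewrite /trinom !bin0. Qed.

Lemma trinomS0 m a : trinom m.+1 a.+1 0 = (trinom m a.+1 0 + trinom m.+1 a 0)%N.
Proof. by rewrite /trinom !bin0 !muln1 !addn0 !addSn binS addnS. Qed.

Lemma trinom0S m n : trinom m.+1 0 n.+1 = (trinom m 0 n.+1 + trinom m.+2 0 n)%N.
Proof. by rewrite /trinom !bin0 !mul1n doubleS !addSn !addnS binS. Qed.

(** Pascal's rule for the trinomial with lower indices [m + n], [n], [a]: each summand lowers one of
    them. *)
Lemma trinomSS m a n : trinom m.+1 a.+1 n.+1 =
  (trinom m a.+1 n.+1 + trinom m.+2 a.+1 n + trinom m.+1 a n.+1)%N.
Proof.
rewrite /trinom doubleS !addSn !addnS binS mulnDl; congr (_ + _)%N.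
by rewrite binS mulnDr.
Qed.

Lemma central_binomial n : 'C(n.+1.*2, n.+1) = ('C(n.*2.+1, n) + 'C(n.*2.+1, n))%N.
Proof.
rewrite doubleS binS; congr (_ + _)%N.
by rewrite -(@bin_sub n.*2.+1 n) ?subSn -?addnn ?addnK; [|lia|lia].
Qed.

Lemma trinom_edge0 n : trinom 0 0 n.+1 = (trinom 1 0 n + trinom 1 0 n)%N.
Proof. by rewrite /trinom !bin0 !mul1n add0n add1n central_binomial. Qed.

Lemma trinom_edgeS a n : trinom 0 a.+1 n.+1 =
  (trinom 1 a.+1 n + trinom 1 a.+1 n + trinom 0 a n.+1)%N.
Proof.
rewrite /trinom !add0n add1n [in LHS]addnS binS mulnDl; congr (_ + _)%N.
by rewrite central_binomial mulnDr doubleS addSnnS.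
Qed.

Definition trinom_term (R : realType) (x : R) m a n : R := (trinom m a n)%:R * x ^+ n.

Lemma trinom_term_ge0 (R : realType) (x : R) m a n : 0 <= x -> 0 <= trinom_term x m a n.
Proof. by move=> x0; rewrite mulr_ge0 // exprn_ge0. Qed.

(** From [C(M, a) <= (1 + w) ^ M / w ^ a] and [C(M, n) <= 2 ^ M]. As [w] tends to 0 the ratio tends
    to [4 x], so any [x < 1/4] is within reach. *)
Lemma trinom_term_bound (R : realType) (x w : R) m a n : 0 <= x -> 0 < w ->
  trinom_term x m a n <= ((1 + w) / w) ^+ a * (2 * (1 + w)) ^+ m
                          * ((2 * (1 + w)) ^+ 2 * x) ^+ n.
Proof.
move=> x0 w0; have wa : 0 < w ^+ a by rewrite exprn_gt0.
have w1 : 0 <= 1 + w by rewrite addr_ge0 // ltW.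
rewrite /trinom_term /trinom natrM expr_div_n.
have h1 := binomial_le_pow (m + n.*2 + a) a (ltW w0).
have h2 : 'C(m + n.*2, n)%:R <= 2 ^+ (m + n.*2) :> R.
  by have := @binomial_le_pow R 1 (m + n.*2) n ler01; rewrite expr1n mulr1.
have h3 : 'C(m + n.*2 + a, a)%:R <= (1 + w) ^+ (m + n.*2 + a) / w ^+ a.
  by rewrite ler_pdivlMr.
rewrite [_ ^+ n in X in _ <= X]exprMn mulrA ler_wpM2r ?exprn_ge0 //.
rewrite (le_trans (ler_pM _ _ h3 h2)) // -exprM -mul2n.
by rewrite exprD exprD [2 ^+ (m + _)]exprD !exprMn; lra.
Qed.

Lemma cvg_trinom (R : realType) (x w : R) m a : 0 <= x -> 0 < w -> (2 * (1 + w)) ^+ 2 * x < 1 ->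
  cvgn (series (trinom_term x m a)).
Proof.
move=> x0 w0 lt; have w1 : 0 <= 1 + w by rewrite addr_ge0 // ltW.
have q0 : 0 <= (2 * (1 + w)) ^+ 2 * x by rewrite mulr_ge0 ?exprn_ge0 ?mulr_ge0.
apply: (@series_le_cvg _ _ (geometric (((1 + w) / w) ^+ a * (2 * (1 + w)) ^+ m)
   ((2 * (1 + w)) ^+ 2 * x))).
- by move=> n; exact: trinom_term_ge0.
- move=> n; rewrite /geometric /= !mulr_ge0 ?exprn_ge0 ?divr_ge0 ?mulr_ge0 //; exact: ltW.
- move=> n; exact: trinom_term_bound.
by apply: is_cvg_geometric_series; rewrite ger0_norm.
Qed.

Definition trinom_sum (R : realType) (x : R) m a : R := limn (series (trinom_term x m a)).

Lemma trinom_sum_bound (R : realType) (x w : R) a :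
  0 <= x -> 0 < w -> (2 * (1 + w)) ^+ 2 * x < 1 ->
  exists K, forall m, `|trinom_sum x m a| <= K * (2 * (1 + w)) ^+ m.
Proof.
move=> x0 w0 lt; have w1 : 0 <= 1 + w by rewrite addr_ge0 // ltW.
have q0 : 0 <= (2 * (1 + w)) ^+ 2 * x by rewrite mulr_ge0 ?exprn_ge0 ?mulr_ge0.
exists (((1 + w) / w) ^+ a / (1 - (2 * (1 + w)) ^+ 2 * x)) => m.
have cv := @cvg_trinom R x w m a x0 w0 lt.
rewrite ger0_norm; last first.
  apply: limr_ge => //; apply: nearW => n.
  by rewrite seriesEnat /=; apply: sumr_ge0 => i _; exact: trinom_term_ge0.
have nq : `|(2 * (1 + w)) ^+ 2 * x| < 1 by rewrite ger0_norm.
pose c := ((1 + w) / w) ^+ a * (2 * (1 + w)) ^+ m.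
have cg : series (geometric c ((2 * (1 + w)) ^+ 2 * x)) @ \oo --> c / (1 - (2 * (1 + w)) ^+ 2 * x).
  exact: cvg_geometric_series.
have := lim_series_le cv (is_cvg_geometric_series (a := c) nq)
  (fun n => @trinom_term_bound R x w m a n x0 w0).
rewrite (cvg_lim _ cg) // /c.
by rewrite mulrAC.
Qed.

Lemma cvg_series_recl (R : realType) (F G : nat -> R) (c b : R) :
  series G n @[n --> \oo] --> b -> (forall n, F n.+1 = c * G n) ->
  series F n @[n --> \oo] --> F 0%N + c * b.
Proof.
move=> cG FG; rewrite -cvg_shiftS.
have -> : [sequence series F n.+1]_n = (fun n => F 0%N + c * series G n).
  apply/funext => n /=; rewrite !seriesEord /= big_ord_recl mulr_sumr; congr (_ + _).
  by apply: eq_bigr => i _; rewrite lift0 FG.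
exact: (cvgD (cvg_cst _) (cvgMl_tmp cG)).
Qed.

Lemma cvg_seriesD (R : realType) (F G : nat -> R) (a b : R) :
  series F n @[n --> \oo] --> a -> series G n @[n --> \oo] --> b ->
  series (fun n => F n + G n) n @[n --> \oo] --> a + b.
Proof.
move=> cF cG; have -> : series (fun n => F n + G n) = (fun n => series F n + series G n).
  by apply/funext => n; rewrite !seriesEord /= big_split.
exact: cvgD.
Qed.

Lemma trinom_sum_rec (R : realType) (x w : R) :
  0 <= x -> 0 < w -> (2 * (1 + w)) ^+ 2 * x < 1 ->
  [/\ forall m, trinom_sum x m.+1 0 = trinom_sum x m 0 + x * trinom_sum x m.+2 0,
      forall m a, trinom_sum x m.+1 a.+1 =
        trinom_sum x m a.+1 + trinom_sum x m.+1 a + x * trinom_sum x m.+2 a.+1,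
      trinom_sum x 0 0 = 1 + 2 * x * trinom_sum x 1 0 &
      forall a, trinom_sum x 0 a.+1 = trinom_sum x 0 a + 2 * x * trinom_sum x 1 a.+1].
Proof.
move=> x0 w0 lt.
have cv m a : series (trinom_term x m a) n @[n --> \oo] --> trinom_sum x m a.
  exact: (@cvg_trinom R x w).
(* Shift of a series by one index; as [trinom_term] already contains [x ^ n], the lost power of [x]
   is carried by [c]. *)
pose sh (c : R) (G : nat -> R) n := if n is k.+1 then c * G k else 0.
have csh c m a : series (sh c (trinom_term x m a)) n @[n --> \oo] --> c * trinom_sum x m a.
  by have := cvg_series_recl (F := sh c (trinom_term x m a)) (c := c) (cv m a) (fun=> erefl);
     rewrite add0r.
split=> [m|m a||a].
- apply: cvg_lim => //.
  have -> : trinom_term x m.+1 0 = (fun n => trinom_term x m 0 n + sh x (trinom_term x m.+2 0) n).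
    apply/funext => -[|n]; rewrite /sh /trinom_term ?trinom00 ?addr0 //.
    by rewrite trinom0S natrD exprS; ring.
  exact: cvg_seriesD.
- apply: cvg_lim => //.
  have -> : trinom_term x m.+1 a.+1 = (fun n => trinom_term x m a.+1 n +
     trinom_term x m.+1 a n + sh x (trinom_term x m.+2 a.+1) n).
    apply/funext => -[|n]; rewrite /sh /trinom_term.
      by rewrite trinomS0 natrD addr0 mulrDl.
    by rewrite trinomSS !natrD exprS; ring.
  by apply: cvg_seriesD => //; exact: cvg_seriesD.
- apply: cvg_lim => //.
  have t00 : trinom_term x 0 0 0 = 1 by rewrite /trinom_term trinom00 mulr1.
  have := cvg_series_recl (F := trinom_term x 0 0) (c := 2 * x) (cv 1%N 0%N).
  rewrite t00; apply => n.
  by rewrite /trinom_term trinom_edge0 natrD exprS; ring.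
- apply: cvg_lim => //.
  have -> : trinom_term x 0 a.+1 = (fun n => trinom_term x 0 a n + sh (2 * x) (trinom_term x 1 a.+1) n).
    apply/funext => -[|n]; rewrite /sh /trinom_term.
      by rewrite /trinom !bin0 !add0n !binn addr0.
    by rewrite trinom_edgeS !natrD exprS; ring.
  exact: cvg_seriesD.
Qed.

(* The recursion has the characteristic roots [1 + u] and [(1 + u) / u]: the growth bound
   excludes the second one, and the boundary condition the first one. *)
Lemma three_term_unique (R : realType) (u y K : R) (d : nat -> R) :
  0 < u -> u < 1 -> 1 + u < y -> u * y < 1 + u ->
  (forall m, d m.+1 = d m + u / (1 + u) ^+ 2 * d m.+2) ->
  d 0%N = 2 * (u / (1 + u) ^+ 2) * d 1%N ->
  (forall m, `|d m| <= K * y ^+ m) -> forall m, d m = 0.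
Proof.
move=> u0 u1 y1 uy rec bnd dK.
have q0 : 1 + u != 0 by rewrite gt_eqF // addr_gt0.
have une : u != 0 by rewrite gt_eqF.
have yp : 0 < y by apply: lt_trans y1; rewrite addr_gt0.
(* This combination removes the root [1 + u], so [e] is geometric with the other root as its
   ratio. *)
pose e m := d m.+1 - (1 + u) * d m.
have eS m : e m.+1 = (1 + u) / u * e m.
  rewrite /e.
  have -> : d m.+2 = (d m.+1 - d m) * ((1 + u) ^+ 2 / u).
    by rewrite (rec m); field; rewrite une q0.
  by field.
have eE m : e m = ((1 + u) / u) ^+ m * e 0%N.
  by elim: m => [|m IH]; rewrite ?expr0 ?mul1r // eS IH exprS mulrA.
have K0 : 0 <= K by have := dK 0%N; rewrite expr0 mulr1; apply: le_trans.
have eK m : `|e m| <= (K * y + (1 + u) * K) * y ^+ m.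
  rewrite /e (le_trans (ler_normB _ _)) // [X in _ <= X]mulrDl lerD //.
    by rewrite -mulrA -exprS.
  rewrite normrM ger0_norm ?addr_ge0 ?(ltW u0) // -mulrA ler_wpM2l //.
  by rewrite addr_ge0 // ltW.
have e0 : e 0%N = 0.
  apply/eqP; rewrite -normr_eq0; apply/eqP.
  pose s := u * y / (1 + u).
  have s0 : 0 <= s by rewrite /s divr_ge0 ?mulr_ge0 ?addr_ge0 // ltW.
  have s1 : s < 1 by rewrite /s ltr_pdivrMr ?addr_gt0 // mul1r.
  have cst : (fun=> `|e 0%N|) @ \oo --> (0 : R).
    apply: (@cvg0_geometric _ _ (K * y + (1 + u) * K) s) => // n.
    rewrite normr_id.
    have -> : `|e 0%N| = (u / (1 + u)) ^+ n * `|e n|.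
      rewrite (eE n) normrM normrX ger0_norm ?divr_ge0 ?addr_ge0 ?(ltW u0) //.
      rewrite mulrA -exprMn (_ : u / (1 + u) * ((1 + u) / u) = 1) ?expr1n ?mul1r //.
      by field; rewrite une q0.
    have p0 : 0 <= (u / (1 + u)) ^+ n.
      by rewrite exprn_ge0 // divr_ge0 ?addr_ge0 ?(ltW u0).
    rewrite (le_trans (ler_wpM2l p0 (eK n))) // mulrCA ler_wpM2l //.
      by rewrite addr_ge0 ?mulr_ge0 ?addr_ge0 ?(ltW u0) ?(ltW yp).
    by rewrite -exprMn /s mulrAC.
  exact: (cvg_unique (@norm_hausdorff _ _) (cvg_cst _) cst).
have e0m m : e m = 0 by rewrite eE e0 mulr0.
have d1 : d 1%N = (1 + u) * d 0%N by apply/eqP; rewrite -subr_eq0; apply/eqP/(e0m 0%N).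
have d0 : d 0%N = 0.
  (* With [d 1 = (1 + u) d 0] the boundary condition reads [d 0 = 2 u / (1 + u) * d 0], which forces
     [d 0 = 0] as [u < 1]. *)
  have : d 0%N * ((1 - u) / (1 + u)) = 0.
    move: bnd; rewrite d1 => h; transitivity (d 0%N - d 0%N * (2 * u / (1 + u))).
      by field.
    by rewrite {1}h; field.
  move/eqP; rewrite mulf_eq0 => /orP[/eqP //|].
  by rewrite mulf_eq0 invr_eq0 (negbTE q0) orbF subr_eq0 gt_eqF.
by elim=> // m IH; have := e0m m; rewrite /e IH mulr0 subr0.
Qed.

(* Differs from [kerK] by a constant factor, and obeys the same recursion as [trinom_sum]. *)
Definition trinomB (R : realType) (v : R) (N m a : nat) : R :=
  \sum_(j < N) 'C(a + j, j)%:R * 'C(m + a, m + j)%:R * v ^+ j.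

Lemma trinomB_trunc (R : realType) (v : R) N m a : (a < N)%N ->
  trinomB v N.+1 m a = trinomB v N m a.
Proof.
move=> lt; rewrite /trinomB big_ord_recr /= (@bin_small (m + a)) ?mulr0 ?mul0r ?addr0 //.
by rewrite ltn_add2l.
Qed.

Lemma trinomB_widen (R : realType) (v : R) N m a : (a < N)%N ->
  trinomB v N m a = trinomB v a.+1 m a.
Proof.
move=> lt; have -> : N = (a.+1 + (N - a.+1))%N by lia.
by elim: (N - a.+1)%N => [|k IH]; rewrite ?addn0 // addnS trinomB_trunc ?IH //; lia.
Qed.

Lemma trinomB_recS (R : realType) (v : R) N m a : (a.+1 < N)%N ->
  (1 + 2 * v) * trinomB v N m.+1 a.+1 =
  (1 + v) * trinomB v N m a.+1 + v * trinomB v N m.+2 a.+1 + trinomB v N m.+1 a.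
Proof.
case: N => // N lt.
(* What Pascal's rule leaves of a difference in [m]; the recursion then reduces to Pascal's rule for
   [C(a.+1 + j, j)]. *)
pose X j : R := 'C(m + a.+1, m.+1 + j)%:R.
have d1 : trinomB v N.+1 m.+1 a.+1 - trinomB v N.+1 m a.+1 =
   \sum_(j < N.+1) 'C(a.+1 + j, j)%:R * X j * v ^+ j.
  rewrite /trinomB -sumrB; apply: eq_bigr => j _.
  by rewrite /X addSn addSn binS natrD; ring.
have d2 : trinomB v N.+1 m.+2 a.+1 - trinomB v N.+1 m.+1 a.+1 =
   \sum_(j < N.+1) 'C(a.+1 + j, j)%:R * (X j + X j.+1) * v ^+ j.
  rewrite /trinomB -sumrB; apply: eq_bigr => j _.
  by rewrite /X !addSn !addnS !binS !natrD; ring.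
suff : trinomB v N.+1 m.+1 a =
  (trinomB v N.+1 m.+1 a.+1 - trinomB v N.+1 m a.+1)
  + v * (trinomB v N.+1 m.+1 a.+1 - trinomB v N.+1 m a.+1)
  - v * (trinomB v N.+1 m.+2 a.+1 - trinomB v N.+1 m.+1 a.+1) by move=> ->; ring.
rewrite d1 d2 !mulr_sumr -addrA -sumrB.
have -> : \sum_(i < N.+1) (v * ('C(a.+1 + i, i)%:R * X i * v ^+ i)
     - v * ('C(a.+1 + i, i)%:R * (X i + X i.+1) * v ^+ i)) =
   - \sum_(i < N) 'C(a.+1 + i, i)%:R * X i.+1 * v ^+ i.+1.
  rewrite -sumrN big_ord_recr /= /X (@bin_small _ (m.+1 + N.+1)); last by lia.
  rewrite !addr0 subrr addr0; apply: eq_bigr => j _; rewrite exprS; ring.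
rewrite big_ord_recl -addrA -sumrB [in LHS]/trinomB big_ord_recl; congr (_ + _).
  by rewrite /X !bin0 addSnnS.
apply: eq_bigr => j _.
by rewrite lift0 /X !addSn !addnS (binS (a + j).+1 j) natrD; ring.
Qed.

Lemma trinomB_rec0 (R : realType) (v : R) N a : (a.+1 < N)%N ->
  (1 + 2 * v) * trinomB v N 0 a.+1 = 2 * v * trinomB v N 1 a.+1 + trinomB v N 0 a.
Proof.
case: N => // N lt.
pose X j : R := 'C(a.+1, j)%:R.
have d1 : trinomB v N.+1 1 a.+1 - trinomB v N.+1 0 a.+1 =
   \sum_(j < N.+1) 'C(a.+1 + j, j)%:R * X j.+1 * v ^+ j.
  rewrite /trinomB -sumrB; apply: eq_bigr => j _.
  by rewrite /X !add0n !add1n (binS a.+1) natrD; ring.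
suff : trinomB v N.+1 0 a = trinomB v N.+1 0 a.+1 -
   2 * v * (trinomB v N.+1 1 a.+1 - trinomB v N.+1 0 a.+1) by move=> ->; ring.
rewrite d1 big_ord_recr /= /X (@bin_small a.+1 N.+1); last by lia.
rewrite mulr0 mul0r addr0 mulr_sumr /trinomB big_ord_recl [in RHS]big_ord_recl.
rewrite -addrA -sumrB; congr (_ + _); first by rewrite !bin0.
apply: eq_bigr => j _; rewrite lift0 !addSn !addnS !add0n.
have jne : j.+1%:R != 0 :> R by rewrite pnatr_eq0.
(* After multiplication by [j + 1] both sides equal [(a + 1) C(a + j + 1, j) C(a, j)]. *)
have key : 'C((a + j).+1, j.+1)%:R * 'C(a, j)%:R = 'C(a.+1, j.+1)%:R * 'C((a + j).+1, j)%:R :> R.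
  apply: (mulfI jne); rewrite -!natrM !mulnA.
  have h : (j.+1 * 'C((a + j).+1, j.+1) = a.+1 * 'C((a + j).+1, j))%N.
    by rewrite mul_bin_left; congr muln; lia.
  have h2 : (j.+1 * 'C(a.+1, j.+1) = a.+1 * 'C(a, j))%N by rewrite -mul_bin_diag.
  by rewrite h h2 mulnAC.
rewrite (binS (a + j).+1 j) natrD.
transitivity ('C((a + j).+1, j.+1)%:R * ('C(a, j.+1)%:R + 'C(a, j)%:R) * v ^+ j.+1 -
    'C((a + j).+1, j.+1)%:R * 'C(a, j)%:R * v ^+ j.+1); first by ring.
by rewrite key -natrD -binS exprS; ring.
Qed.

Lemma trinomB_kerK (R : realType) (v : R) m a :
  trinomB v a.+1 m a = (m + a)`!%:R / (a`!%:R * a`!%:R) * kerK m a v.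
Proof.
rewrite /trinomB /kerK mulr_sumr; apply: eq_bigr => j _.
have lej : (j <= a)%N by rewrite -ltnS.
rewrite !binomialE //; try lia.
have -> : (a + j - j = a)%N by lia.
have -> : (m + a - (m + j) = a - j)%N by lia.
move: (natf_neq0 R a) (natf_neq0 R j) (natf_neq0 R (a - j)) (natf_neq0 R (m + j)).
move: (a`!%:R) (j`!%:R) ((a - j)`!%:R) ((m + j)`!%:R) => x y z t hx hy hz ht.
by field; rewrite hx hy hz ht.
Qed.

Lemma trinomB_bound (R : realType) (v w : R) N a : 0 <= v -> 0 < w ->
  (a < N)%N -> exists2 K, 0 <= K & forall m, `|trinomB v N m a| <= K * (1 + w) ^+ m.
Proof.
move=> v0 w0 lt; have w1 : 0 <= 1 + w by rewrite addr_ge0 // ltW.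
pose k (j : nat) := 'C(a + j, j)%:R * ((1 + w) ^+ a / w ^+ (a - j)) * v ^+ j.
exists (\sum_(j < a.+1) k j).
  by apply: sumr_ge0 => j _; rewrite !mulr_ge0 ?invr_ge0 ?exprn_ge0 // ltW.
move=> m; rewrite trinomB_widen // ger0_norm; last first.
  by apply: sumr_ge0 => j _; rewrite !mulr_ge0 ?exprn_ge0.
rewrite mulr_suml; apply: ler_sum => j _.
have lej : (j <= a)%N by rewrite -ltnS.
rewrite /k [X in _ <= X]mulrAC ler_wpM2r ?exprn_ge0 // -mulrA ler_wpM2l //.
have -> : 'C(m + a, m + j) = 'C(m + a, a - j).
  by rewrite -bin_sub; [congr binomial; lia|lia].
rewrite mulrAC ler_pdivlMr ?exprn_gt0 // -exprD addnC.
exact/binomial_le_pow/ltW.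
Qed.

(** Induction on [a]: the inhomogeneous term of the recursion in [m] is the value at [a - 1], so it
    cancels in the difference of the two sides, to which [three_term_unique] applies. *)
Lemma trinom_sum_closed (R : realType) (u v w x : R) m a :
  0 < u -> u < 1 -> 0 < w -> x = u / (1 + u) ^+ 2 -> v = u / (1 - u) ->
  (2 * (1 + w)) ^+ 2 * x < 1 -> u * (2 * (1 + w)) < 1 + u ->
  trinom_sum x m a =
  (1 + u) ^+ (m + a).+1 / (1 - u) ^+ a.+1 * trinomB v a.+1 m a.
Proof.
move=> u0 u1 w0 xE vE lt.
have : 2 < 2 * (1 + w) by lra.
have : 2 * (1 + w) = 2 * (1 + w) by [].
move: {2 3 4}(2 * (1 + w)) => y yE y2 uy.
have q0 : 0 < 1 + u by rewrite addr_gt0.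
have x0 : 0 <= x by rewrite xE; apply: divr_ge0; [exact: ltW|apply: exprn_ge0; exact: ltW].
have [rS0 rSS r00 r0S] := trinom_sum_rec x0 w0 lt.
have une : 1 - u != 0 by rewrite gt_eqF // subr_gt0.
have qne : 1 + u != 0 by rewrite gt_eqF.
have v12 : 1 + 2 * v = (1 + u) / (1 - u) by rewrite vE; field.
have v1 : 1 + v = (1 - u)^-1 by rewrite vE; field.
pose N := a.+2; have ltaN : (a.+1 < N)%N by [].
move: N ltaN => N ltaN.
pose Psi m b := (1 + u) ^+ (m + b).+1 / (1 - u) ^+ b.+1 * trinomB v N m b.
have PsiE k b : Psi k b = (1 + u) ^+ (k + b).+1 / (1 - u) ^+ b.+1 * trinomB v N k b by [].
move: Psi PsiE => Psi PsiE.
suff main : forall b, (b <= a)%N -> forall m, trinom_sum x m b - Psi m b = 0.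
  apply/eqP; rewrite -subr_eq0; apply/eqP; have := main a (leqnn a) m.
  by rewrite PsiE trinomB_widen // ltnW.
have growth b : (b <= a)%N -> exists K, forall m, `|trinom_sum x m b - Psi m b| <= K * y ^+ m.
  move=> leb; have ltb : (b < N)%N by apply: leq_trans _ ltaN; rewrite ltnS (leq_trans leb).
  have [K1] := @trinom_sum_bound R x w b x0 w0 lt; rewrite yE => h1.
  have v0 : 0 <= v by rewrite vE divr_ge0 ?(ltW u0) // subr_ge0 ltW.
  have [K2 K20 h2] := @trinomB_bound R v w N b v0 w0 ltb.
  pose c := (1 + u) ^+ b.+1 / (1 - u) ^+ b.+1.
  have c0 : 0 <= c by rewrite /c divr_ge0 ?exprn_ge0 ?(ltW q0) // subr_ge0 ltW.
  exists (K1 + c * K2) => k; rewrite (le_trans (ler_normB _ _)) // mulrDl lerD //.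
  rewrite PsiE.
  have -> : (1 + u) ^+ (k + b).+1 / (1 - u) ^+ b.+1 = c * (1 + u) ^+ k.
    by rewrite /c -addnS exprD; ring.
  have cu : `|c * (1 + u) ^+ k| = c * (1 + u) ^+ k.
    by rewrite ger0_norm // mulr_ge0 // exprn_ge0 // ltW.
  rewrite normrM cu -2!mulrA ler_wpM2l //.
  (* The closed form grows at most like [((1 + u)(1 + w)) ^ k], below [y ^ k] because
     [1 + u < 2]. *)
  have -> : y ^+ k = 2 ^+ k * (1 + w) ^+ k by rewrite -yE exprMn.
  rewrite (le_trans (ler_wpM2l _ (h2 k))) ?exprn_ge0 ?(ltW q0) //.
  rewrite mulrCA ler_wpM2l // ler_wpM2r ?exprn_ge0 ?addr_ge0 ?(ltW w0) //.
  by rewrite lerXn2r ?nnegrE ?(ltW q0) //; lra.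
have y1 : 1 + u < y by lra.
have B0 j : trinomB v N j 0 = 1.
  rewrite trinomB_widen; last exact: leq_trans _ ltaN.
  by rewrite /trinomB big_ord1 !addn0 bin0 binn expr0 !mulr1.
have P0 j : Psi j.+1 0%N = Psi j 0%N + x * Psi j.+2 0%N.
  by rewrite !PsiE !B0 !addn0 !exprS xE; field; rewrite une qne.
have P00 : Psi 0%N 0%N = 1 + 2 * x * Psi 1%N 0%N.
  by rewrite !PsiE !B0 !exprS xE; field; rewrite une qne.
have PS j b : (b < a)%N -> Psi j.+1 b.+1 = Psi j b.+1 + Psi j.+1 b + x * Psi j.+2 b.+1.
  move=> ltb; have ltN : (b.+1 < N)%N by apply: leq_trans _ ltaN; rewrite !ltnS ltnW.
  have := trinomB_recS v j ltN; rewrite v12 v1 => E.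
  have {}E : trinomB v N j.+1 b.+1 = (1 - u) / (1 + u) * ((1 - u)^-1 * trinomB v N j b.+1 +
      v * trinomB v N j.+2 b.+1 + trinomB v N j.+1 b) by rewrite -E; field; rewrite une qne.
  rewrite !PsiE E.
  move: (trinomB v N j b.+1) (trinomB v N j.+2 b.+1) (trinomB v N j.+1 b) => A B C.
  have pn : (1 - u) ^+ b != 0 by rewrite expf_neq0.
  rewrite vE xE !addnS !addSn !exprS; move: ((1 - u) ^+ b) ((1 + u) ^+ (j + b)) pn => p q pn.
  by field; rewrite pn une qne.
have PS0 b : (b < a)%N -> Psi 0%N b.+1 = Psi 0%N b + 2 * x * Psi 1%N b.+1.
  move=> ltb; have ltN : (b.+1 < N)%N by apply: leq_trans _ ltaN; rewrite !ltnS ltnW.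
  have := trinomB_rec0 v ltN; rewrite v12 => E.
  have {}E : trinomB v N 0 b.+1 = (1 - u) / (1 + u) * (2 * v * trinomB v N 1 b.+1
    + trinomB v N 0 b) by rewrite -E; field; rewrite une qne.
  rewrite !PsiE E.
  move: (trinomB v N 1 b.+1) (trinomB v N 0 b) => A B.
  have pn : (1 - u) ^+ b != 0 by rewrite expf_neq0.
  rewrite vE xE !add0n !add1n !exprS; move: ((1 - u) ^+ b) ((1 + u) ^+ b) pn => p q pn.
  by field; rewrite pn une qne.
elim=> [|b IH] leb k; have [K hK] := growth _ leb;
  apply: (@three_term_unique _ u y K (fun k => trinom_sum x k _ - Psi k _)) => //; rewrite -xE.
- by move=> j; rewrite rS0 P0; ring.
- by rewrite r00 P00; ring.
- move=> j; rewrite rSS PS //.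
  have -> : trinom_sum x j.+1 b = Psi j.+1 b.
    by apply/eqP; rewrite -subr_eq0; apply/eqP/IH/ltnW.
  by ring.
rewrite r0S PS0 //.
have -> : trinom_sum x 0 b = Psi 0%N b.
  by apply/eqP; rewrite -subr_eq0; apply/eqP/IH/ltnW.
by ring.
Qed.

(* With [u = t ^+ 2] and [x = (t / (1 + t ^+ 2)) ^+ 2] this is the quadratic transformation
   of the Gauss series. *)
Lemma trinom_sumE (R : realType) (t : R) m a : 0 < t -> t < 1 ->
  cvgn (series (trinom_term (t ^+ 2 / (1 + t ^+ 2) ^+ 2) m a)) /\
  trinom_sum (t ^+ 2 / (1 + t ^+ 2) ^+ 2) m a =
  (1 + t ^+ 2) ^+ (m + a).+1 / (1 - t ^+ 2) ^+ a.+1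
    * trinomB (t ^+ 2 / (1 - t ^+ 2)) a.+1 m a.
Proof.
move=> t0 t1; set u := t ^+ 2; set x := u / (1 + u) ^+ 2; set v := u / (1 - u).
have u0 : 0 < u by rewrite exprn_gt0.
have u1 : u < 1 by rewrite exprn_ilt1 // ltW.
(* Makes [2 (1 + w)] the midpoint of [2] and [(1 + u) / t]; both smallness conditions then follow
   from [t * y < 1 + u]. *)
pose w := ((1 + u) / t - 2) / 4.
have tu : 2 * t < 1 + u.
  by have : 0 < (1 - t) ^+ 2; [rewrite exprn_gt0 // subr_gt0|rewrite /u; lra].
have w0 : 0 < w.
  by rewrite /w divr_gt0 // subr_gt0 ltr_pdivlMr.
pose y := 2 * (1 + w).
have tne : t != 0 by rewrite gt_eqF.
have q0 : 0 < 1 + u by rewrite addr_gt0.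
have yE : y = ((1 + u) / t + 2) / 2 by rewrite /y /w; field.
have y2 : 2 < y by rewrite /y; lra.
have y0 : 0 < y by apply: lt_trans y2.
have ty : t * y < 1 + u.
  have -> : t * y = ((1 + u) + 2 * t) / 2 by rewrite yE; field.
  by lra.
have x0 : 0 <= x by apply: divr_ge0; [exact: ltW|apply: exprn_ge0; exact: ltW].
have lt : (2 * (1 + w)) ^+ 2 * x < 1.
  have -> : (2 * (1 + w)) ^+ 2 * x = (t * y / (1 + u)) ^+ 2.
    by rewrite -/y /x /u; field; rewrite -/u gt_eqF.
  rewrite exprn_ilt1 //.
    by apply: divr_ge0; [apply: mulr_ge0|]; exact: ltW.
  by rewrite ltr_pdivrMr // mul1r.
have uy : u * y < 1 + u.
  rewrite (le_lt_trans _ ty) // ler_wpM2r //; first exact: ltW.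
  by rewrite /u expr2 ger_pMl // ltW.
split; first exact: (@cvg_trinom R x w).
exact: (@trinom_sum_closed R u v w x m a).
Qed.

(** * Legendre functions of half-integer degree and order *)

Lemma Gamma_nat (R : realType) n : Gamma (n.+1%:R : R) = n`!%:R.
Proof.
have ratio1 k : (fun N : nat => N`!%:R * N%:R ^+ k / (N + k)`!%:R : R) @ \oo --> (1 : R).
  elim: k => [|k IH].
    have -> : (fun N : nat => N`!%:R * N%:R ^+ 0 / (N + 0)`!%:R : R) = fun=> 1.
      by apply/funext => N; rewrite addn0 mulr1 divff // natf_neq0.
    exact: cvg_cst.
  (* The new factor is [N / (N + k + 1) = 1 - (k + 1) / (N + k + 1)]. *)
  have -> : (fun N : nat => N`!%:R * N%:R ^+ k.+1 / (N + k.+1)`!%:R : R) =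
    (fun N : nat => (N`!%:R * N%:R ^+ k / (N + k)`!%:R) * (1 - k.+1%:R * harmonic (N + k)%N)).
    apply/funext => N; rewrite /harmonic /= addnS factS (natrM _ (N + k).+1) exprS.
    have ne : (N + k).+1%:R != 0 :> R by rewrite pnatr_eq0.
    have e : N%:R = (N + k).+1%:R - k.+1%:R :> R by rewrite -addnS natrD addrK.
    move: (natf_neq0 R (N + k)); rewrite [X in _ * (X * _)]e.
    move: ((N + k)`!%:R) ((N + k).+1%:R) ne (k.+1%:R) (N`!%:R) (N%:R ^+ k) => A B hB C D F hA.
    by field; rewrite hA hB.
  have h0 : (fun N : nat => harmonic (N + k)%N : R) @ \oo --> (0 : R).
    by have := @cvg_harmonic R; rewrite -(cvg_shiftn k).
  have := cvgM IH (cvgB (cvg_cst (1 : R)) (cvgMl_tmp (a := k.+1%:R) h0)).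
  by rewrite mulr0 subr0 mulr1; apply.
rewrite /Gamma; apply: cvg_lim => //.
have -> : (fun N : nat => N`!%:R * N%:R `^ n.+1%:R / pochhammer n.+1%:R N.+1 : R) =
  (fun N : nat => n`!%:R * (N`!%:R * N%:R ^+ n.+1 / (N + n.+1)`!%:R)).
  apply/funext => N; rewrite powR_mulrn // pochhammer_nat addnS addnC addnS.
  move: (natf_neq0 R n) (natf_neq0 R (N + n).+1).
  move: (n`!%:R) ((N + n).+1`!%:R) => A B hA hB.
  by field; rewrite hA hB.
by have := cvgMl_tmp (a := n`!%:R) (ratio1 n.+1); rewrite mulr1; apply.
Qed.

(** Duplication: the two products interlace to [(b + 1)(b + 2) ... (b + 2 n)], every factor being
    halved. *)
Lemma pochhammer_half (R : realType) b n :
  pochhammer (b.+1%:R / 2) n * pochhammer (b.+2%:R / 2) n * 4 ^+ n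
   = (b + n.*2)`!%:R / b`!%:R :> R.
Proof.
elim: n => [|n IH].
  by rewrite /pochhammer !big_ord0 addn0 divff ?natf_neq0 // !mulr1.
rewrite !pochhammerSr doubleS !addnS factS (natrM _ (b + n.*2).+2) factS (natrM _ (b + n.*2).+1).
rewrite exprS -[(b + n.*2).+2%:R]natr1 -[(b + n.*2).+1%:R]natr1 natrD -muln2 natrM muln2.
have -> : (b%:R + n%:R * 2%:R + 1 + 1) * ((b%:R + n%:R * 2%:R + 1) * (b + n.*2)`!%:R) / b`!%:R =
  (b%:R + n%:R * 2%:R + 1 + 1) * (b%:R + n%:R * 2%:R + 1) * ((b + n.*2)`!%:R / b`!%:R) :> R by ring.
by rewrite -IH -[b.+2%:R]natr1 -[b.+1%:R]natr1; field.
Qed.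

Lemma trinomE (R : realType) m a n :
  (trinom m a n)%:R = (m + n.*2 + a)`!%:R / (a`!%:R * (m + n)`!%:R * n`!%:R) :> R.
Proof.
rewrite /trinom natrM !binomialE; [|lia|lia].
have -> : (m + n.*2 + a - a = m + n.*2)%N by lia.
have -> : (m + n.*2 - n = m + n)%N by lia.
move: (natf_neq0 R a) (natf_neq0 R n) (natf_neq0 R (m + n)) (natf_neq0 R (m + n.*2)).
move: (a`!%:R) (n`!%:R) ((m + n)`!%:R) ((m + n.*2)`!%:R) => x y z s hx hy hz hs.
by field; rewrite hx hy hz hs.
Qed.

(** Since [1 / zeta ^ 2 = 4 x], the powers of 4 are absorbed by the duplication formula, and each
    Gauss term is a fixed multiple of a trinomial term. *)
Lemma hyp2F1_half (R : realType) (t : R) m a : 0 < t -> t < 1 ->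
  hyp2F1 ((m + a).+1%:R / 2) ((m + a).+2%:R / 2) m.+1%:R (1 / ((1 + t ^+ 2) / (2 * t)) ^+ 2)
  = m`!%:R / a`!%:R * (1 + t ^+ 2) ^+ (m + a).+1 / (1 - t ^+ 2) ^+ a.+1
      * kerK m a (t ^+ 2 / (1 - t ^+ 2)).
Proof.
move=> t0 t1; have [cv sE] := trinom_sumE m a t0 t1.
have tne : t != 0 by rewrite gt_eqF.
have q0 : 1 + t ^+ 2 != 0 by rewrite gt_eqF // addr_gt0 // exprn_gt0.
pose c : R := m`!%:R * a`!%:R / (m + a)`!%:R.
rewrite /hyp2F1 (_ : (fun n => _) = (fun n => c * trinom_term (t ^+ 2 / (1 + t ^+ 2) ^+ 2) m a n)).
  have -> : series (fun n => c * trinom_term (t ^+ 2 / (1 + t ^+ 2) ^+ 2) m a n) =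
     (fun n => c * series (trinom_term (t ^+ 2 / (1 + t ^+ 2) ^+ 2) m a) n).
    by apply/funext => n; rewrite !seriesEord /= mulr_sumr.
  have := cvgMl_tmp (a := c) cv => h.
  transitivity (c * trinom_sum (t ^+ 2 / (1 + t ^+ 2) ^+ 2) m a).
    by apply: cvg_lim => //; exact: h.
  rewrite sE trinomB_kerK /c.
  move: (natf_neq0 R m) (natf_neq0 R a) (natf_neq0 R (m + a)).
  move: (m`!%:R) (a`!%:R) ((m + a)`!%:R) (kerK _ _ _) => x y z k hx hy hz.
  move: ((1 + _) ^+ _) ((1 - t ^+ 2) ^- _) => A B.
  by field; rewrite hy hz.
apply/funext => n; rewrite /trinom_term trinomE pochhammer_nat /c.
have -> : 1 / ((1 + t ^+ 2) / (2 * t)) ^+ 2 = 4 * (t ^+ 2 / (1 + t ^+ 2) ^+ 2).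
  by field; rewrite tne q0.
rewrite exprMn; set y := (_ / _) ^+ n.
have := pochhammer_half R (m + a) n; set P := pochhammer _ _; set P' := pochhammer _ _ => E.
have -> : P * P' / ((m + n)`!%:R / m`!%:R * n`!%:R) * (4 ^+ n * y) =
   (P * P' * 4 ^+ n) / ((m + n)`!%:R / m`!%:R * n`!%:R) * y by ring.
rewrite E; have -> : (m + a + n.*2 = m + n.*2 + a)%N by lia.
move: (natf_neq0 R m) (natf_neq0 R a) (natf_neq0 R (m + a)) (natf_neq0 R n) (natf_neq0 R (m + n)).
move: (m`!%:R) (a`!%:R) ((m + a)`!%:R) (n`!%:R) ((m + n)`!%:R) => x1 x2 x3 x4 x5 h1 h2 h3 h4 h5.
by field; rewrite h1 h2 h3 h4 h5.
Qed.

Lemma expi_half (R : realType) a : expi (pi * (a%:R + 1 / 2) : R) = 0 +i* (-1) ^+ a.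
Proof.
rewrite /expi; elim: a => [|a IH].
  have -> : pi * (0 + 1 / 2) = pi / 2 :> R by ring.
  by rewrite cos_pihalf sin_pihalf.
have -> : pi * (a.+1%:R + 1 / 2) = pi * (a%:R + 1 / 2) + pi :> R by rewrite -natr1; ring.
rewrite cosDpi sinDpi exprS; case: IH => -> ->.
by rewrite oppr0 mulN1r.
Qed.

(** Degree plus order is an integer, so both Gamma values are factorials; only the square roots of
    [pi], of 2 and of [S = sqrt (zeta ^ 2 - 1)] stay unevaluated. *)
Lemma legendreQ_half (R : realType) (t : R) m a : 0 < t -> t < 1 ->
  legendreQ (m%:R - 1 / 2) (a%:R + 1 / 2) ((1 + t ^+ 2) / (2 * t)) =
  'i%C * ((-1) ^+ a * Num.sqrt pi * ((m + a)`!%:R / a`!%:R)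
   * (((1 - t ^+ 2) / (2 * t)) `^ (1 / 2) / (2 `^ (1 / 2) * ((1 - t ^+ 2) / (2 * t))))
   * t ^+ m * kerK m a (t ^+ 2 / (1 - t ^+ 2)))%:C.
Proof.
move=> t0 t1; set S := (1 - t ^+ 2) / (2 * t).
have tne : t != 0 by rewrite gt_eqF.
have q0 : 0 < 1 + t ^+ 2 by rewrite addr_gt0 // exprn_gt0.
have p0 : 0 < 1 - t ^+ 2 by rewrite subr_gt0 exprn_ilt1 // ltW.
have S0 : 0 < S by rewrite divr_gt0 // mulr_gt0.
have z0 : 0 < (1 + t ^+ 2) / (2 * t) by rewrite divr_gt0 // mulr_gt0.
rewrite /legendreQ expi_half.
have -> : m%:R - 1 / 2 + (a%:R + 1 / 2) + 1 = (m + a).+1%:R :> R.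
  by rewrite -[(m + a).+1%:R]natr1 natrD; field.
have -> : m%:R - 1 / 2 + (a%:R + 1 / 2) + 2 = (m + a).+2%:R :> R.
  by rewrite -[(m + a).+2%:R]natr1 -[(m + a).+1%:R]natr1 natrD; field.
have -> : m%:R - 1 / 2 + 3 / 2 = m.+1%:R :> R by rewrite -[m.+1%:R]natr1; field.
have -> : m%:R - 1 / 2 + 1 = m%:R + 1 / 2 :> R by field.
rewrite hyp2F1_half // !Gamma_nat.
have -> : ((1 + t ^+ 2) / (2 * t)) ^+ 2 - 1 = S ^+ 2 by rewrite /S; field.
have -> : (S ^+ 2) `^ ((a%:R + 1 / 2) / 2) = S ^+ a * S `^ (1 / 2).
  rewrite -(powR_mulrn 2 (ltW S0)) -powRrM.
  have -> : 2%:R * ((a%:R + 1 / 2) / 2) = a%:R + 1 / 2 :> R by field.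
  by rewrite powRD ?powR_mulrn ?(ltW S0) // (gt_eqF S0) implybT.
have -> : 2 `^ (m%:R + 1 / 2) = 2 ^+ m * 2 `^ (1 / 2) :> R.
  by rewrite powRD ?powR_mulrn // pnatr_eq0 implybT.
rewrite powR_mulrn ?(ltW z0) //.
have two0 : 2 `^ (1 / 2) != 0 :> R by rewrite gt_eqF // powR_gt0.
have -> : (Num.sqrt pi)%:C * (0 +i* (-1) ^+ a) *
   ((m + a)`!%:R * (S ^+ a * S `^ (1 / 2)) /
    (2 ^+ m * 2 `^ (1 / 2) * m`!%:R * ((1 + t ^+ 2) / (2 * t)) ^+ (m + a).+1) *
    (m`!%:R / a`!%:R * (1 + t ^+ 2) ^+ (m + a).+1 / (1 - t ^+ 2) ^+ a.+1 *
     kerK m a (t ^+ 2 / (1 - t ^+ 2))))%:C =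
   'i%C * (Num.sqrt pi * (-1) ^+ a * ((m + a)`!%:R * (S ^+ a * S `^ (1 / 2)) /
    (2 ^+ m * 2 `^ (1 / 2) * m`!%:R * ((1 + t ^+ 2) / (2 * t)) ^+ (m + a).+1) *
    (m`!%:R / a`!%:R * (1 + t ^+ 2) ^+ (m + a).+1 / (1 - t ^+ 2) ^+ a.+1 *
     kerK m a (t ^+ 2 / (1 - t ^+ 2)))))%:C.
  by apply/eqP; rewrite eq_complex /=; apply/andP; split; apply/eqP; ring.
congr (_ * _%:C).
have pne := lt0r_neq0 p0; have qne := lt0r_neq0 q0.
rewrite /S; move: pne qne; move: (1 - t ^+ 2) (1 + t ^+ 2) => p q pne qne.
rewrite !expr_div_n !exprMn !exprS !exprD.
move: (natf_neq0 R m) (natf_neq0 R a) two0.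
have := expf_neq0 a pne; have := expf_neq0 m qne; have := expf_neq0 a qne.
have := expf_neq0 m tne; have := expf_neq0 a tne.
have two : 2 != 0 :> R by rewrite pnatr_eq0.
have := expf_neq0 m two; have := expf_neq0 a two.
move: (2 ^+ a) (2 ^+ m) (t ^+ a) (t ^+ m) (q ^+ a) (q ^+ m) (p ^+ a) (m`!%:R) (a`!%:R) (2 `^ _)
 ((m + a)`!%:R) ((p / (2 * t)) `^ _) (kerK _ _ _).
move=> x1 x2 x3 x4 x5 x6 x7 x8 x9 y1 y2 y3 y4 h1 h2 h3 h4 h5 h6 h7 h8 h9 g1.
by field; rewrite h1 h2 h3 h4 h5 h6 h7 h8 h9 g1 tne pne qne.
Qed.

(** * Matching the expansion coefficients with the terms of the theorem *)

(** The two inner sums of the theorem are one sum over orders [a < p + mu], cut at [a = l + mu];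
    below the cut [cffact] vanishes, so there the bracket has only one summand. *)
Lemma kappa_sum_split (R : realType) (q : nat -> R) (p l mu : nat) : (l <= p)%N ->
  (p + l + 2 * mu)`!%:R^-1 * (\sum_(0 <= s < p - l)
    (2 * l + 2 * s + 2 * mu + 1)%:R / (s`! * (p - l - s) * (p + l + s + 2 * mu + 1))%:R
      * (1 + (s`! * (p + l + 2 * mu)`!)%:R / ((s + 2 * l + 2 * mu)`! * (p - l)`!)%:R)
      * q (s + l + mu)%N)
  + (p - l)`!%:R^-1 * (\sum_(0 <= s < l + mu)
    (2 * s + 1)%:R / ((l + s + mu)`! * (p + mu - s) * (p + s + mu + 1))%:R * q s) =
  \sum_(a < p + mu) kappa R (p + mu) a *
    (1 / (p - l)`!%:R + cffact R a (l + mu) / (p + l + 2 * mu)`!%:R)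
      * (q a / (l + mu + a)`!%:R).
Proof.
move=> lelp; rewrite -(big_mkord xpredT (fun a => kappa R (p + mu) a *
    (1 / (p - l)`!%:R + cffact R a (l + mu) / (p + l + 2 * mu)`!%:R)
      * (q a / (l + mu + a)`!%:R))).
have lemn : (l + mu <= p + mu)%N by rewrite leq_add2r.
rewrite (big_cat_nat (leq0n _) lemn).
rewrite addrC; congr (_ + _).
  rewrite mulr_sumr; apply: eq_big_nat => s /andP[_ lts].
  rewrite cffact_small // mul0r addr0 /kappa.
  have -> : (l + mu + s = l + s + mu)%N by lia.
  have -> : (p + mu + s + 1 = p + s + mu + 1)%N by lia.
  rewrite -mulnA (natrM _ (l + s + mu)`!).
  have ne : ((p + mu - s) * (p + s + mu + 1))%:R != 0 :> R.
    by rewrite pnatr_eq0 muln_eq0; apply/norP; lia.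
  move: (natf_neq0 R (l + s + mu)) (natf_neq0 R (p - l)) ne.
  move: ((l + s + mu)`!%:R) ((p - l)`!%:R) (((p + mu - s) * (p + s + mu + 1))%:R) => x y z hx hy hz.
  by field; rewrite hx hy hz.
rewrite -[X in _ = \sum_(X <= _ < _) _](add0n (l + mu)%N) big_addn.
have -> : (p + mu - (l + mu) = p - l)%N by lia.
rewrite mulr_sumr; apply: eq_big_nat => s /andP[_ lts].
rewrite cffactE; last by lia.
rewrite /kappa.
have -> : (p + mu - (s + (l + mu)) = p - l - s)%N by lia.
have -> : (p + mu + (s + (l + mu)) + 1 = p + l + s + 2 * mu + 1)%N by lia.
have -> : (2 * (s + (l + mu)) + 1 = 2 * l + 2 * s + 2 * mu + 1)%N by lia.
have -> : (s + (l + mu) + (l + mu) = s + 2 * l + 2 * mu)%N by lia.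
have -> : (s + (l + mu) - (l + mu) = s)%N by lia.
have -> : (l + mu + (s + (l + mu)) = s + 2 * l + 2 * mu)%N by lia.
rewrite addnA -mulnA (natrM _ s`!) (natrM _ s`!) (natrM _ (_ + _)`!).
have ne : ((p - l - s) * (p + l + s + 2 * mu + 1))%:R != 0 :> R.
  by rewrite pnatr_eq0 muln_eq0; apply/norP; lia.
move: (natf_neq0 R s) (natf_neq0 R (p - l)) (natf_neq0 R (p + l + 2 * mu))
  (natf_neq0 R (s + 2 * l + 2 * mu)) ne.
move: (s`!%:R) ((p - l)`!%:R) ((p + l + 2 * mu)`!%:R) ((s + 2 * l + 2 * mu)`!%:R)
  (((p - l - s) * (p + l + s + 2 * mu + 1))%:R) => x y z t k hx hy hz ht hk.
by field; rewrite hx hy hz ht hk.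
Qed.

(** Here [P] stands for the real prefactor and [q a] for Q divided by [i], whence the leading minus
    sign. The sign [(-1) ^ a] carried by [q a] supplies the alternation in [coefD_small]. *)
Lemma ecoef_head (R : realType) (kap t P c0 : R) (q : nat -> R) (p l mu : nat) :
  t ^+ 2 != 1 -> (l <= p)%N ->
  (forall a, P * q a = c0 * t ^+ l * (1 - t ^+ 2) ^+ (p + mu) * (-1) ^+ a *
     ((l + mu + a)`!%:R / a`!%:R) * kerK (l + mu) a (t ^+ 2 / (1 - t ^+ 2))) ->
  let H := harm R in
  - P * (-1) ^+ l * (
    (kap + 2 * H (2 * p + 2 * mu)%N + H p - H (p + mu)%N) * (-1) ^+ (p + mu + 1)
      * (q (p + mu)%N / ((p - l)`! * (l + p + 2 * mu)`!)%:R)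
  + (-1) ^+ (p + mu) * (q (p + mu)%N / ((p - l)`! * (p + l + 2 * mu)`!)%:R
       * (H (p + l + 2 * mu)%N + H (p - l)%N))
  + (-1) ^+ (p + mu + 1) *
   ((p + l + 2 * mu)`!%:R^-1 * (\sum_(0 <= s < p - l)
    (2 * l + 2 * s + 2 * mu + 1)%:R / (s`! * (p - l - s) * (p + l + s + 2 * mu + 1))%:R
      * (1 + (s`! * (p + l + 2 * mu)`!)%:R / ((s + 2 * l + 2 * mu)`! * (p - l)`!)%:R)
      * q (s + l + mu)%N))
  + (-1) ^+ (p + mu + 1) *
    ((p - l)`!%:R^-1 * (\sum_(0 <= s < l + mu)
      (2 * s + 1)%:R / ((l + s + mu)`! * (p + mu - s) * (p + s + mu + 1))%:R * q s)))
  = c0 / p`!%:R * ecoef kap t p mu l.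
Proof.
move=> u1 lelp hq H.
rewrite -[X in _ * X = _]addrA -mulrDr kappa_sum_split // /ecoef.
rewrite (coefA_kerK u1) ?leq_add2r // (coefD_small u1) ?leq_add2r //.
have -> : (2 * p + 2 * mu = 2 * (p + mu))%N by lia.
have -> : (l + p + 2 * mu = p + l + 2 * mu)%N by lia.
have -> : (p + mu - (l + mu) = p - l)%N by lia.
have -> : (p + mu + (l + mu) = p + l + 2 * mu)%N by lia.
rewrite -/H; set n := (p + mu)%N; set v := t ^+ 2 / (1 - t ^+ 2).
set L := \sum_(a < n) _; set L' := \sum_(a < n) _.
have PL : P * L = c0 * t ^+ l * (1 - t ^+ 2) ^+ n * (-1) ^+ n * L'.
  rewrite /L /L' !mulr_sumr; apply: eq_bigr => a _; rewrite exprD.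
  have s1 : (-1) ^+ n * (-1) ^+ n = 1 :> R by rewrite -expr2 sqrr_sign.
  set k := kappa R n a; set b := (1 / _ + _).
  transitivity (k * b * (P * q a) / (l + mu + a)`!%:R); first by ring.
  rewrite hq -/n -/v.
  transitivity ((-1) ^+ n * (-1) ^+ n * (c0 * t ^+ l * (1 - t ^+ 2) ^+ n * (-1) ^+ a * k * b
     * kerK (l + mu) a v / a`!%:R)); last by ring.
  rewrite s1 mul1r; move: (natf_neq0 R (l + mu + a)) (natf_neq0 R a).
  move: ((l + mu + a)`!%:R) (a`!%:R) => x y hx hy.
  by field; rewrite hx hy.
have s1 : (-1) ^+ n * (-1) ^+ n = 1 :> R by rewrite -expr2 sqrr_sign.
have := hq n; rewrite -/n -/v.
have -> : (l + mu + n = p + l + 2 * mu)%N by rewrite /n; lia.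
move=> Pq; rewrite addn1 exprS natrM.
have PL1 : P * (-1) ^+ n * L = c0 * t ^+ l * (1 - t ^+ 2) ^+ n * L'.
  transitivity ((-1) ^+ n * (P * L)); first by ring.
  rewrite PL; transitivity ((-1) ^+ n * (-1) ^+ n * (c0 * t ^+ l * (1 - t ^+ 2) ^+ n * L')).
    by ring.
  by rewrite s1 mul1r.
have Pq1 : P * (-1) ^+ n * q n = c0 * t ^+ l * (1 - t ^+ 2) ^+ n *
   ((p + l + 2 * mu)`!%:R / n`!%:R) * kerK (l + mu) n v.
  transitivity ((-1) ^+ n * (P * q n)); first by ring.
  rewrite Pq; transitivity ((-1) ^+ n * (-1) ^+ n * (c0 * t ^+ l * (1 - t ^+ 2) ^+ n *
   ((p + l + 2 * mu)`!%:R / n`!%:R) * kerK (l + mu) n v)); first by ring.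
  by rewrite s1 mul1r.
have key (F f g X Y : R) : - P * F * (X * (-1 * (-1) ^+ n) * (q n / (f * g)) +
   (-1) ^+ n * (q n / (f * g) * Y) + -1 * (-1) ^+ n * L) =
   F * ((X - Y) * (P * (-1) ^+ n * q n) / (f * g) + P * (-1) ^+ n * L) by ring.
rewrite key Pq1 PL1.
move: (natf_neq0 R p) (natf_neq0 R n) (natf_neq0 R (p + l + 2 * mu)) (natf_neq0 R (p - l)).
move: (p`!%:R) (n`!%:R) ((p + l + 2 * mu)`!%:R) ((p - l)`!%:R) => x1 x2 x3 x4 h1 h2 h3 h4.
move: ((1 - t ^+ 2) ^+ n) (kerK _ _ _) => A B.
by field; rewrite h1 h2 h3 h4.
Qed.

(** Beyond [p] the part with [coefA] vanishes; on both sides the sign reduces to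
    [(-1) ^ (p + 1)]. *)
Lemma ecoef_tail (R : realType) (kap t P c0 : R) (q : nat -> R) (p l mu : nat) :
  t ^+ 2 != 1 -> (p < l)%N ->
  (forall a, P * q a = c0 * t ^+ l * (1 - t ^+ 2) ^+ (p + mu) * (-1) ^+ a *
     ((l + mu + a)`!%:R / a`!%:R) * kerK (l + mu) a (t ^+ 2 / (1 - t ^+ 2))) ->
  - P * (-1) ^+ mu * ((l - p - 1)`!%:R / (p + l + 2 * mu)`!%:R * q (p + mu)%N)
  = c0 / p`!%:R * ecoef kap t p mu l.
Proof.
move=> u1 ltpl hq; rewrite /ecoef coefA_eq0 ?ltn_add2r // mulr0 addr0.
rewrite (coefD_large u1) ?ltn_add2r //.
have -> : (l + mu - (p + mu) - 1 = l - p - 1)%N by lia.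
set c := (l - p - 1)`!%:R / _.
transitivity (- (-1) ^+ mu * c * (P * q (p + mu)%N)); first by ring.
rewrite hq /c.
have -> : (l + mu + (p + mu) = p + l + 2 * mu)%N by lia.
have -> : (-1) ^+ l * t ^+ l = - ((-1) ^+ (l - p - 1)) * (-1) ^+ p * t ^+ l :> R.
  rewrite -[l in X in X * _ = _](_ : (l - p - 1).+1 + p = l)%N; last by lia.
  by rewrite exprD exprS; ring.
rewrite [(-1) ^+ (p + mu)]exprD.
have s1 k : (-1) ^+ k * (-1) ^+ k = 1 :> R by rewrite -expr2 sqrr_sign.
move: (natf_neq0 R p) (natf_neq0 R (p + mu)) (natf_neq0 R (p + l + 2 * mu)).
move: (p`!%:R) ((p + mu)`!%:R) ((p + l + 2 * mu)`!%:R) ((l - p - 1)`!%:R) => x y z f hx hy hz.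
transitivity (- ((-1) ^+ mu * (-1) ^+ mu) * (-1) ^+ p * f * c0 * t ^+ l * (1 - t ^+ 2) ^+ (p + mu)
   / y * kerK (l + mu) (p + mu) (t ^+ 2 / (1 - t ^+ 2))).
  by field; rewrite hy hz.
rewrite s1.
transitivity (- ((-1) ^+ (l - p - 1) * (-1) ^+ (l - p - 1)) * (-1) ^+ p * f * c0 * t ^+ l *
  (1 - t ^+ 2) ^+ (p + mu) / y * kerK (l + mu) (p + mu) (t ^+ 2 / (1 - t ^+ 2))).
  by rewrite s1.
by field; rewrite hx hy.
Qed.

(** All values of Q are purely imaginary, so convergence of the complex series is a real
    question. *)
Lemma cvg_imC (R : realType) (f : nat -> R) (a : R) : f n @[n --> \oo] --> a ->
  (fun n => ('i%C * (f n)%:C : R[i]^o)) @ \oo --> ('i%C * a%:C : R[i]^o).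
Proof.
move=> fa; apply/cvgrPdist_lt => e; rewrite ltcE /= => /andP[/eqP e0 ep].
have /cvgrPdist_lt/(_ _ ep) := fa.
apply: filterS => n h; rewrite -mulrBr -rmorphB normrM.
have -> : `|'i%C : R[i]| = 1 by rewrite normc_def /= expr0n expr1n add0r sqrtr1.
rewrite mul1r normc_def /= expr0n addr0 sqrtr_sqr ltcE /= e0 eqxx /=.
exact: h.
Qed.

Local Close Scope classical_set_scope.

(** * Euclidean norms, the parameter [t] and the prefactor *)

Lemma dotp_ge0 (R : realType) d (x : 'rV[R]_d) : 0 <= dotp x x.
Proof. by apply: sumr_ge0 => i _; rewrite -expr2 sqr_ge0. Qed.

Lemma enorm_sqr (R : realType) d (x : 'rV[R]_d) : enorm x ^+ 2 = dotp x x.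
Proof. exact/sqr_sqrtr/dotp_ge0. Qed.

Lemma enorm_sub_sqr (R : realType) d (x y : 'rV[R]_d) :
  enorm (x - y) ^+ 2 = enorm x ^+ 2 + enorm y ^+ 2 - 2 * dotp x y.
Proof.
rewrite !enorm_sqr /dotp mulr_sumr -big_split -sumrB; apply: eq_bigr => i _ /=.
by rewrite !mxE; ring.
Qed.

Lemma zeta_param (R : realType) (r r' : R) : 0 < r -> 0 < r' -> r <> r' ->
  exists t, [/\ 0 < t, t < 1 & (r ^+ 2 + r' ^+ 2) / (2 * r * r') = (1 + t ^+ 2) / (2 * t)].
Proof.
move=> r0 r'0 /eqP; rewrite neq_lt => /orP[lt|lt].
  exists (r / r'); split; first by rewrite divr_gt0.
    by rewrite ltr_pdivrMr // mul1r.
  by field; rewrite !gt_eqF.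
exists (r' / r); split; first by rewrite divr_gt0.
  by rewrite ltr_pdivrMr // mul1r.
by field; rewrite !gt_eqF.
Qed.

Lemma zeta_sqr_sub1 (R : realType) (t : R) : t != 0 ->
  ((1 + t ^+ 2) / (2 * t)) ^+ 2 - 1 = ((1 - t ^+ 2) / (2 * t)) ^+ 2.
Proof. by move=> t0; field. Qed.

Lemma zeta_add_sqrt (R : realType) (t : R) : 0 < t -> t < 1 ->
  (1 + t ^+ 2) / (2 * t) + Num.sqrt (((1 + t ^+ 2) / (2 * t)) ^+ 2 - 1) = t^-1.
Proof.
move=> t0 t1; have tne : t != 0 by rewrite gt_eqF.
rewrite zeta_sqr_sub1 // sqrtr_sqr ger0_norm; first by field.
by rewrite divr_ge0 ?mulr_ge0 ?(ltW t0) // subr_ge0 exprn_ile1 // ltW.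
Qed.

(** With [S = sqrt (zeta ^ 2 - 1)] the real power is [S ^ (p + mu + 3/2)], as the parameter of the
    theorem is [mu.+1] here. All square roots cancel, and [1 - t ^ 2 = 2 t S] absorbs the rest. *)
Lemma prefactor_legendre (R : realType) (t rr q k : R) (p mu l a : nat) :
  0 < t -> t < 1 ->
  2 `^ (mu.+1%:R - 1 / 2) / Num.sqrt pi * p`!%:R * Gamma mu.+1%:R
    * (((1 + t ^+ 2) / (2 * t)) ^+ 2 - 1) `^ ((p + mu.+1)%:R / 2 + 1 / 4) * (2 * rr) ^+ p
  * ((-1) ^+ a * Num.sqrt pi * q
   * (((1 - t ^+ 2) / (2 * t)) `^ (1 / 2) / (2 `^ (1 / 2) * ((1 - t ^+ 2) / (2 * t))))
   * t ^+ (l + mu.+1) * k)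
  = (1 / 2 * (rr / t) ^+ p * p`!%:R * mu`!%:R) * t ^+ l * (1 - t ^+ 2) ^+ (p + mu.+1)
     * (-1) ^+ a * q * k :> R.
Proof.
move=> t0 t1; have tne : t != 0 by rewrite gt_eqF.
have p0 : 0 < 1 - t ^+ 2 by rewrite subr_gt0 exprn_ilt1 // ltW.
rewrite Gamma_nat zeta_sqr_sub1 //.
have S0 : 0 < (1 - t ^+ 2) / (2 * t) by rewrite divr_gt0 // mulr_gt0.
have SE : (1 - t ^+ 2) ^+ (p + mu.+1) = (2 * t * ((1 - t ^+ 2) / (2 * t))) ^+ (p + mu.+1).
  by congr (_ ^+ _); field.
rewrite SE; move: S0; move: ((1 - t ^+ 2) / (2 * t)) => S S0.
have Sne : S != 0 by rewrite gt_eqF.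
have -> : (S ^+ 2) `^ ((p + mu.+1)%:R / 2 + 1 / 4) = S ^+ (p + mu.+1) * S `^ (1 / 2).
  rewrite -(powR_mulrn 2 (ltW S0)) -powRrM.
  have -> : 2%:R * ((p + mu.+1)%:R / 2 + 1 / 4) = (p + mu.+1)%:R + 1 / 2 :> R by field.
  by rewrite powRD ?powR_mulrn ?(ltW S0) // Sne implybT.
have -> : 2 `^ (mu.+1%:R - 1 / 2) = 2 ^+ mu.+1 / 2 `^ (1 / 2) :> R.
  rewrite -mulNr powRD; last by rewrite pnatr_eq0 implybT.
  by rewrite powR_mulrn // mulNr powRN.
have T2 : 2 `^ (1 / 2) * 2 `^ (1 / 2) = 2 :> R.
  rewrite -powRD; last by rewrite pnatr_eq0 implybT.
  by rewrite -mulrDl (_ : (1 + 1) / 2 = 1) ?powRr1 //; field.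
have S2 : S `^ (1 / 2) * S `^ (1 / 2) = S.
  rewrite -powRD; last by rewrite Sne implybT.
  by rewrite -mulrDl (_ : (1 + 1) / 2 = 1) ?powRr1 ?(ltW S0) //; field.
have T0 : 2 `^ (1 / 2) != 0 :> R by rewrite gt_eqF // powR_gt0.
have pi0 : Num.sqrt pi != 0 :> R by rewrite gt_eqF // sqrtr_gt0 pi_gt0.
move: T0 T2 S2 pi0; move: (2 `^ _) (S `^ _) (Num.sqrt _) => T s P T0 T2 S2 P0.
move: (p`!%:R) (mu`!%:R) => g h.
transitivity (2 ^+ mu.+1 * (s * s) / (T * T) / S * S ^+ (p + mu.+1) * (2 * rr) ^+ p *
   t ^+ (l + mu.+1) * g * h * (-1) ^+ a * q * k).
  by field; rewrite T0 P0 Sne.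
rewrite S2 T2 !exprMn exprVn !exprD !exprS.
have := expf_neq0 p tne; move: (t ^+ p) => tp tp0.
by field; rewrite tp0 Sne.
Qed.

(** The logarithm of the norm is half that of [(r r' / t) h]; this gives the factor [1 / 2] and
    doubles [beta_pd]. *)
Lemma frakl_log (R : realType) (d k : nat) (x x' : 'rV[R]_d) (g t : R) :
  ~~ odd d -> (d./2 <= k)%N -> 0 < t -> t < 1 -> 0 < enorm x -> 0 < enorm x' ->
  cos g = dotp x x' / (enorm x * enorm x') ->
  (enorm x ^+ 2 + enorm x' ^+ 2) / (2 * enorm x * enorm x') = (1 + t ^+ 2) / (2 * t) ->
  let h := 1 - 2 * t * cos g + t ^+ 2 in
  let p := (k - d./2)%N in
  frakl k x x' = 1 / 2 * (enorm x * enorm x' / t) ^+ p * (h ^+ p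
    * (ln h + (ln (enorm x * enorm x') + ln t^-1 - 2 * beta_pd R p d))).
Proof.
move=> d_even le_d2_k t0 t1 r0 r'0 cosg zE h p.
have tne : t != 0 by rewrite gt_eqF.
have rr0 : 0 < enorm x * enorm x' by rewrite mulr_gt0.
have h0 : 0 < h.
  by apply: lt_le_trans (quad_lb g (ltW t0)); rewrite exprn_gt0 // subr_gt0.
have E : enorm (x - x') ^+ 2 = enorm x * enorm x' / t * h.
  rewrite enorm_sub_sqr; have -> : dotp x x' = cos g * (enorm x * enorm x').
    by rewrite cosg divfK // gt_eqF.
  have -> : enorm x ^+ 2 + enorm x' ^+ 2 = (1 + t ^+ 2) / (2 * t) * (2 * enorm x * enorm x').
    by rewrite -zE divfK // gt_eqF // -mulrA mulr_gt0.
  by rewrite /h; field.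
have E0 : 0 < enorm x * enorm x' / t * h by rewrite mulr_gt0 // divr_gt0.
have n0 : 0 < enorm (x - x').
  rewrite lt_def sqrtr_ge0 andbT; apply/eqP => e0.
  by move: E0; rewrite -E e0 expr0n ltxx.
have lnE : ln (enorm (x - x')) = 1 / 2 * (ln (enorm x * enorm x') + ln t^-1 + ln h).
  have : ln (enorm (x - x') ^+ 2) = ln (enorm x * enorm x') + ln t^-1 + ln h.
    by rewrite E !lnM ?posrE ?invr_gt0 // mulr_gt0 // invr_gt0.
  by rewrite lnXn // => <-; rewrite -mulr_natr; field.
rewrite /frakl lnE -/p.
have -> : (2 * k)%:Z - d%:Z = (2 * p)%:Z.
  have := odd_double_half d; rewrite (negbTE d_even) add0n -mul2n => dE.
  by rewrite subzn; [congr Posz; rewrite /p; lia|lia].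
rewrite -exprnP exprM E exprMn.
move: (_ ^+ p) (h ^+ p) (ln (_ * _)) (ln t^-1) (ln h) (beta_pd _ _ _) => A B C D F G.
by field.
Qed.

Lemma sum_imC (R : realType) (a b : nat) (f g : nat -> R) (G : nat -> R[i]) :
  (forall l, G l = 'i%C * (g l)%:C) ->
  \sum_(a <= l < b) (f l)%:C * G l = 'i%C * (\sum_(a <= l < b) f l * g l)%:C.
Proof.
move=> GE; rewrite rmorph_sum mulr_sumr; apply: eq_bigr => l _.
by rewrite GE rmorphM /=; ring.
Qed.

Theorem theorem5p2 (R : realType) (d k mu : nat) (x x' : 'rV[R]_d) (gamma : R)
  (d_gt0 : (0 < d)%N) (d_even : ~~ odd d)
  (k_gt0 : (0 < k)%N) (le_d2_k : (d./2 <= k)%N)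
  (mu_gt0 : (0 < mu)%N)
  (r_gt0 : 0 < enorm x) (r'_gt0 : 0 < enorm x') (r_neq_r' : enorm x <> enorm x')
  (gamma_ge0 : 0 <= gamma) (gamma_le_pi : gamma <= pi)
  (cos_gamma : cos gamma = dotp x x' / (enorm x * enorm x')) :
  let p := (k - d./2)%N in
  let r := enorm x in
  let r' := enorm x' in
  let zeta := (r ^+ 2 + r' ^+ 2) / (2 * r * r') in
  let H := harm R in
  (* Q l a = Q_{l+mu-1/2}^{a+1/2}(zeta) *)
  let Q (l a : nat) : R[i] :=
    legendreQ ((l + mu)%:R - 1 / 2) (a%:R + 1 / 2) zeta in
  (* W l = (l+mu) C_l^mu(cos gamma) *)
  let W (l : nat) : R := (l + mu)%:R * (gegenbauer l mu%:R).[cos gamma] in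
  let tail (l : nat) : R[i] :=
    (W l * (l - p - 1)`!%:R / (p + l + 2 * mu)`!%:R)%:C * Q l (p + mu)%N in
  let tail_sum (n : nat) : R[i]^o := \sum_(p.+1 <= l < n) tail l in
  cvgn tail_sum /\
  (frakl k x x')%:C =
  'i%C * (2 `^ (mu%:R - 1 / 2) / Num.sqrt pi * p`!%:R * Gamma mu%:R
        * (zeta ^+ 2 - 1) `^ ((p + mu)%:R / 2 + 1 / 4)
        * (2 * r * r') ^+ p)%:C *
  ( (ln (r * r') + ln (zeta + Num.sqrt (zeta ^+ 2 - 1))
       + 2 * H (2 * p + 2 * mu)%N + H p - H (p + mu)%N - 2 * beta_pd R p d)%:C
    * (-1) ^+ (p + mu + 1)
    * (\sum_(0 <= l < p.+1)
         ((-1) ^+ l * W l / ((p - l)`! * (l + p + 2 * mu)`!)%:R)%:C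
         * Q l (p + mu)%N)
  + (-1) ^+ (p + mu)
    * (\sum_(0 <= l < p.+1)
         ((-1) ^+ l * W l / ((p - l)`! * (p + l + 2 * mu)`!)%:R
          * (H (p + l + 2 * mu)%N + H (p - l)%N))%:C
         * Q l (p + mu)%N)
  + (-1) ^+ (p + mu + 1)
    * (\sum_(0 <= l < p)
         ((-1) ^+ l * W l / (p + l + 2 * mu)`!%:R)%:C
         * \sum_(0 <= s < p - l)
             ((2 * l + 2 * s + 2 * mu + 1)%:R
              / (s`! * (p - l - s) * (p + l + s + 2 * mu + 1))%:R
              * (1 + (s`! * (p + l + 2 * mu)`!)%:R
                     / ((s + 2 * l + 2 * mu)`! * (p - l)`!)%:R))%:C
             * Q l (s + l + mu)%N)
  + (-1) ^+ (p + mu + 1)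
    * (\sum_(0 <= l < p.+1)
         ((-1) ^+ l * W l / (p - l)`!%:R)%:C
         * \sum_(0 <= s < l + mu)
             ((2 * s + 1)%:R
              / ((l + s + mu)`! * (p + mu - s) * (p + s + mu + 1))%:R)%:C
             * Q l s)
  + (-1) ^+ mu * (limn tail_sum : R[i]) ).
Proof.
move=> p r r' zeta H Q W tail tail_sum.
have [t [t0 t1 zE]] := zeta_param r_gt0 r'_gt0 r_neq_r'.
have zE' : zeta = (1 + t ^+ 2) / (2 * t) := zE.
have tne : t != 0 by rewrite gt_eqF.
have u1 : t ^+ 2 != 1 by rewrite lt_eqF // exprn_ilt1 // ltW.
have fE := frakl_log d_even le_d2_k t0 t1 r_gt0 r'_gt0 cos_gamma zE.
case: mu mu_gt0 @Q @W @tail @tail_sum => // mu' _ Q W tail tail_sum.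
set mu := mu'.+1 in Q W tail tail_sum *; set n := (p + mu)%N.
pose q l a : R := (-1) ^+ a * Num.sqrt pi * ((l + mu + a)`!%:R / a`!%:R)
   * (((1 - t ^+ 2) / (2 * t)) `^ (1 / 2) / (2 `^ (1 / 2) * ((1 - t ^+ 2) / (2 * t))))
   * t ^+ (l + mu) * kerK (l + mu) a (t ^+ 2 / (1 - t ^+ 2)).
have QE l a : Q l a = 'i%C * (q l a)%:C by rewrite /Q zE' legendreQ_half.
set P : R := 2 `^ (mu%:R - 1 / 2) / Num.sqrt pi * p`!%:R * Gamma mu%:R
  * (zeta ^+ 2 - 1) `^ ((p + mu)%:R / 2 + 1 / 4) * (2 * r * r') ^+ p.
pose c1 : R := 1 / 2 * (r * r' / t) ^+ p.
pose c0 : R := c1 * p`!%:R * mu'`!%:R.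
have hq l a : P * q l a = c0 * t ^+ l * (1 - t ^+ 2) ^+ n * (-1) ^+ a *
     ((l + mu + a)`!%:R / a`!%:R) * kerK (l + mu) a (t ^+ 2 / (1 - t ^+ 2)).
  by rewrite /P /q zE' -[2 * r * r']mulrA prefactor_legendre.
pose kap : R := ln (r * r') + ln t^-1 - 2 * beta_pd R p d.
pose h : R := 1 - 2 * t * cos gamma + t ^+ 2.
pose f l : R := ecoef kap t p mu l * hcosW gamma mu l.
have fW l : c1 * f l = c0 / p`!%:R * ecoef kap t p mu l * W l.
  rewrite /f /c0 /W /mu /hcosW /gegs /=; have := natf_neq0 R p; move: (p`!%:R) => z hz.
  by field.
pose y l : R := W l * (l - p - 1)`!%:R / (p + l + 2 * mu)`!%:R * q l n.
have tailE l : tail l = 'i%C * (y l)%:C.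
  by rewrite /tail QE /y [in RHS]rmorphM /=; ring.
have P0 : P != 0.
  have z0 : 0 < zeta ^+ 2 - 1.
    rewrite zE' zeta_sqr_sub1 // exprn_gt0 // divr_gt0 ?mulr_gt0 //.
    by rewrite subr_gt0 exprn_ilt1 // ltW.
  rewrite /P Gamma_nat !mulf_neq0 ?natf_neq0 ?invr_eq0 ?expf_neq0 ?gt_eqF ?powR_gt0 //.
    by rewrite sqrtr_gt0 pi_gt0.
  by rewrite !mulr_gt0.
pose c2 : R := - P * (-1) ^+ mu.
have c20 : c2 != 0 by rewrite mulf_neq0 ?oppr_eq0 ?signr_eq0.
(* The tail is not summed directly: its limit is what the expansion leaves after the indices up to
   [p], divided by the nonzero factor [c2]. *)
pose Y := c2^-1 * c1 * (h ^+ p * (ln h + kap) - \sum_(l < p.+1) f l).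
have yE l : (p < l)%N -> y l = c2^-1 * c1 * f l.
  move=> ltpl; rewrite -mulrA fW -(ecoef_tail kap u1 ltpl (hq l)) -/c2 -/n.
  transitivity (c2^-1 * c2 * y l); first by rewrite mulVf ?mul1r.
  by rewrite /y; ring.
have cY : (tail_sum @ \oo --> ('i%C * Y%:C : R[i]^o))%classic.
  have -> : tail_sum = (fun N => 'i%C * (\sum_(p.+1 <= l < N) y l)%:C).
    apply/funext => N; rewrite /tail_sum rmorph_sum mulr_sumr.
    by apply: eq_bigr => l _; rewrite tailE.
  apply: cvg_imC.
  have cf : ((\sum_(l < N) f l) @[N --> \oo] --> h ^+ p * (ln h + kap))%classic.
    exact: expansion.
  have cB := cvgMl_tmp (a := c2^-1 * c1) (cvgB cf (cvg_cst (\sum_(l < p.+1) f l))).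
  (* After the shift every partial sum contains the whole head, so the head can be split off. *)
  rewrite -(cvg_shiftn p.+1) in cB; rewrite -(cvg_shiftn p.+1).
  have shiftE : (fun N => \sum_(p.+1 <= l < N + p.+1) y l) =
      (fun N => c2^-1 * c1 * (\sum_(l < N + p.+1) f l - \sum_(l < p.+1) f l)).
    have addKl (A B : R) : A + B - A = B by rewrite addrC addKr.
    apply/funext => N.
    rewrite -(big_mkord xpredT f) -(big_mkord xpredT f) (big_cat_nat (leq0n _) (leq_addl N p.+1)) /=.
    rewrite addKl mulr_sumr; apply: eq_big_nat => l /andP[ltpl _].
    by rewrite yE.
  have cB' : ((fun N => c2^-1 * c1 * (\sum_(l < N + p.+1) f l - \sum_(l < p.+1) f l))
    @ \oo --> Y)%classic by exact: cB.
  by rewrite -shiftE in cB'; exact: cB'.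
split; first by apply/cvg_ex; exists ('i%C * Y%:C : R[i]^o).
have -> : limn tail_sum = 'i%C * Y%:C by apply: cvg_lim => //; exact: norm_hausdorff.
set X : R := ln (r * r') + _ + _ + _ - _ - _.
have XE : X = kap + 2 * H (2 * p + 2 * mu)%N + H p - H (p + mu)%N.
  by rewrite /X zE' zeta_add_sqrt // /kap; ring.
pose w l : R := (-1) ^+ l * W l.
pose z3 l : R := \sum_(0 <= s < p - l)
  (2 * l + 2 * s + 2 * mu + 1)%:R / (s`! * (p - l - s) * (p + l + s + 2 * mu + 1))%:R
    * (1 + (s`! * (p + l + 2 * mu)`!)%:R / ((s + 2 * l + 2 * mu)`! * (p - l)`!)%:R)
    * q l (s + l + mu)%N.
pose z4 l : R := \sum_(0 <= s < l + mu)
  (2 * s + 1)%:R / ((l + s + mu)`! * (p + mu - s) * (p + s + mu + 1))%:R * q l s.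
pose s1 : R := \sum_(0 <= l < p.+1) w l / ((p - l)`! * (l + p + 2 * mu)`!)%:R * q l n.
pose s2 : R := \sum_(0 <= l < p.+1) w l / ((p - l)`! * (p + l + 2 * mu)`!)%:R
  * (H (p + l + 2 * mu)%N + H (p - l)%N) * q l n.
pose s3 : R := \sum_(0 <= l < p) w l / (p + l + 2 * mu)`!%:R * z3 l.
pose s4 : R := \sum_(0 <= l < p.+1) w l / (p - l)`!%:R * z4 l.
rewrite (sum_imC _ _ (fun l => w l / ((p - l)`! * (l + p + 2 * mu)`!)%:R) (fun l => QE l n)) -/s1.
rewrite (sum_imC _ _ (fun l => w l / ((p - l)`! * (p + l + 2 * mu)`!)%:R
  * (H (p + l + 2 * mu)%N + H (p - l)%N)) (fun l => QE l n)) -/s2.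
rewrite (sum_imC _ _ (fun l => w l / (p + l + 2 * mu)`!%:R)
  (fun l => sum_imC _ _ _ (fun s => QE l (s + l + mu)%N))) -/s3.
rewrite (sum_imC _ _ (fun l => w l / (p - l)`!%:R)
  (fun l => sum_imC _ _ _ (fun s => QE l s))) -/s4.
have sgC k' : (-1) ^+ k' = ((-1) ^+ k' : R)%:C :> R[i] by rewrite rmorphXn rmorphN1.
rewrite !sgC.
(* One [i] is explicit in the theorem, the other sits in every Q; their product is the sign in
   [- P]. *)
transitivity (('i%C * 'i%C) * (P%:C * (X%:C * ((-1) ^+ (n + 1))%:C * s1%:C
  + ((-1) ^+ n)%:C * s2%:C + ((-1) ^+ (n + 1))%:C * s3%:C
  + ((-1) ^+ (n + 1))%:C * s4%:C + ((-1) ^+ mu)%:C * Y%:C))) ; last by ring.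
rewrite -expr2 sqr_i mulN1r -!rmorphM -!rmorphD -!rmorphM -rmorphN; congr (_%:C).
(* At [l = p] the inner sum is empty, so all four finite sums can share one range and be compared
   term by term. *)
have s3E : s3 = \sum_(0 <= l < p.+1) w l / (p + l + 2 * mu)`!%:R * z3 l.
  rewrite big_nat_recr //= [X in _ + X](_ : _ = 0) ?addr0 //.
  by rewrite /z3 subnn big_geq ?mulr0.
have head : - P * (X * (-1) ^+ (n + 1) * s1 + (-1) ^+ n * s2 + (-1) ^+ (n + 1) * s3
    + (-1) ^+ (n + 1) * s4) = c1 * \sum_(l < p.+1) f l.
  rewrite s3E /s1 /s2 /s4 -(big_mkord xpredT f) !mulr_sumr -!big_split /= mulr_sumr.
  apply: eq_big_nat => l /andP[_ lel]; rewrite ltnS in lel.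
  rewrite fW -(ecoef_head kap u1 lel (hq l)) -/n -/(z3 l) -/(z4 l) -/H -XE /w.
  move: (_%:R) (z3 l) (z4 l) (q l n) => *; ring.
rewrite fE -/p -/r -/r' -/h -/kap -/c1.
have YE : c2 * Y = c1 * (h ^+ p * (ln h + kap) - \sum_(l < p.+1) f l).
  by rewrite /Y -mulrA mulVKf.
transitivity (- P * (X * (-1) ^+ (n + 1) * s1 + (-1) ^+ n * s2 + (-1) ^+ (n + 1) * s3
    + (-1) ^+ (n + 1) * s4) + c2 * Y); last by rewrite /c2; ring.
by rewrite head YE; ring.
Qed.
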